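(* Let $m=3$, $a\ge0$ and $D_1\ge D_2\ge D_3>0$, and let $\mathcal{F}_1,\mathcal{F}_2$ be the functions of $(a,D_1,D_2,D_3)$ defined in the context. If $\mathcal{F}_1\ge\mathcal{F}_2$, then $$\mathcal{U}(\mathcal{A}_{\mathrm{Hfd}})=\mathcal{U}(\mathcal{A}_{\mathrm{McD}}).$$ If $\mathcal{F}_1<\mathcal{F}_2$, then $$\mathcal{U}(\mathcal{A}_{\mathrm{Hfd}})<\mathcal{U}(\mathcal{A}_{\mathrm{McD}}).$$
   Context: Hoeffding's assumptions: $\mathcal{A}_{\mathrm{Hfd}}$ is the set of pairs $(f,\mu)$ such that $f(X_1,\dots,X_m)=X_1+\dots+X_m$, $\mu\in\bigotimes_{i=1}^m\mathcal{M}([b_i-D_i,b_i])$ for some $b_1,\dots,b_m\in\mathbb{R}$ (i.e. the $X_i$ are independent and $X_i$ takes values in an interval $[b_i-D_i,b_i]$ of length $D_i$), and $\mathbb{E}_\mu[f]\le0$. Here $\mathcal{M}(S)$ is the set of Borel probability measures on $S$. Put $\mathcal{U}(\mathcal{A}_{\mathrm{Hfd}}):=\sup_{(f,\mu)\in\mathcal{A}_{\mathrm{Hfd}}}\mu[f\ge a]$. McDiarmid's assumptions: let $\mathcal{X}=\prod_{i=1}^m\mathcal{X}_i$ be a product of Suslin spaces (continuous images of Polish spaces), each of which can be partitioned into two nonempty Borel sets. Measurability on $\mathcal{X}$ is with respect to the product $\sigma$-algebra, and $\mathcal{M}^m(\mathcal{X})$ is the set of product measures $\mu_1\otimes\dots\otimes\mu_m$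 with $\mu_i$ a Borel probability measure on $\mathcal{X}_i$. For $f\colon\mathcal{X}\to\mathbb{R}$ put $$\operatorname{Osc}_i(f):=\sup_{(x_1,\dots,x_m)\in\mathcal{X}}\ \sup_{x_i'\in\mathcal{X}_i}|f(\dots,x_i,\dots)-f(\dots,x_i',\dots)|.$$ Let $\mathcal{G}$ be the set of measurable $f\colon\mathcal{X}\to\mathbb{R}$ with $\operatorname{Osc}_i(f)\le D_i$ for $i=1,\dots,m$, and define $$\mathcal{A}_{\mathrm{McD}}:=\{(f,\mu)\in\mathcal{G}\times\mathcal{M}^m(\mathcal{X})\mid\mathbb{E}_\mu[f]\le0\},\qquad \mathcal{U}(\mathcal{A}_{\mathrm{McD}}):=\sup_{(f,\mu)\in\mathcal{A}_{\mathrm{McD}}}\mu[f\ge a].$$ Definition of $\mathcal{F}_1$: $$\mathcal{F}_1:=\begin{cases}0,&\text{if }D_1+D_2+D_3\le a,\\[2pt] \dfrac{(D_1+D_2+D_3-a)^3}{27D_1D_2D_3},&\text{if }D_1+D_2-2D_3\le a\le D_1+D_2+D_3,\\[6pt] \dfrac{(D_1+D_2-a)^2}{4D_1D_2},&\text{if }D_1-D_2\le a\le D_1+D_2-2D_3,\\[6pt] 1-\dfrac{a}{D_1},&\text{if }0\le a\le D_1-D_2.\end{cases}$$ Definition of $\mathcal{F}_2$: let $$\psi(\gamma):=\gamma^2\Big(2\frac{D_2}{D_3}-1\Big)-2\gamma\Big(3\frac{D_2}{D_3}-1\Big)+\frac{\gamma}{1+\gamma}\Big(8\frac{D_2}{D_3}-2\frac{a}{D_3}\Big),$$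 $$\theta(\gamma):=1-\frac{a}{D_3(1-\gamma^2)}+\frac{D_2}{D_3}\,\frac{1-\gamma}{1+\gamma},$$ and let $\gamma_1,\gamma_2,\gamma_3\in\mathbb{C}$ be the roots (with multiplicity) in $\gamma$ of $$(1+\gamma)^3-A(1+\gamma)^2+B=0,\qquad A:=\frac{5D_2-2D_3}{2D_2-D_3},\quad B:=\frac{4D_2-a}{2D_2-D_3}.$$ Let $\phi(\gamma):=1$ if $\gamma\in(0,1)$ (in particular $\gamma$ real) and $\theta(\gamma)\in(0,1)$, and $\phi(\gamma):=0$ otherwise. Then $$\mathcal{F}_2:=\max_{i\in\{1,2,3\}}\phi(\gamma_i)\psi(\gamma_i),$$ where a product $\phi(\gamma_i)\psi(\gamma_i)$ with $\phi(\gamma_i)=0$ is understood to be $0$. *)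

(* Defs.v *)
From HB Require Import structures.
From mathcomp Require Import all_boot all_order all_algebra.
From mathcomp Require Import all_classical all_reals all_analysis.
From mathcomp Require Import complex.

Set Implicit Arguments.
Unset Strict Implicit.
Unset Printing Implicit Defensive.

Import Order.TTheory GRing.Theory Num.Theory.
Import numFieldNormedType.Exports.

Local Open Scope classical_set_scope.
Local Open Scope ring_scope.
Local Open Scope complex_scope.

Definition separable_space (T : topologicalType) :=
  exists2 A : set T, countable A & dense A.

Definition cauchy_complete (T : uniformType) :=
  forall F : set_system T, ProperFilter F -> cauchy F -> exists l : T, F --> l.

(* Distances take values in the ambient real field [R]. *)
Definition polish_space (R : realType) (T : topologicalType) :=
  exists (M : metricType R) (g : M -> T) (h : T -> M),
    [/\ cauchy_complete M, separable_space M, cancel g h, cancel h g &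
        continuous g /\ continuous h].

(* No separation axiom is imposed on [T]: some authors also require a Suslin  *)
(* space to be Hausdorff.                                                     *)
Definition suslin_space (R : realType) (T : topologicalType) :=
  exists (P : topologicalType) (g : P -> T),
    [/\ polish_space R P, continuous g & range g = setT].

Notation borel_type T := (g_sigma_algebraType (@open T)).

(* The set [A] and its complement are the two parts. *)
Definition splits_in_two (T : ptopologicalType) :=
  exists A : set (borel_type T),
    [/\ measurable A, A !=set0 & ~` A !=set0].

Section Uncertainty.
Context {R : realType}.

Definition prob3 {d1 d2 d3} {T1 : measurableType d1} {T2 : measurableType d2}
    {T3 : measurableType d3} (mu1 : probability T1 R) (mu2 : probability T2 R)
    (mu3 : probability T3 R) : probability (T1 * T2 * T3)%type R :=
  ((mu1 \x mu2) \x mu3)%E.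

(* Supremum of [mu[f >= a]] over a set of scenarios [(f, mu)]. *)
Definition optimal_bound {d} {T : measurableType d} (a : R)
    (A : set ((T -> R) * probability T R)) : \bar R :=
  ereal_sup [set s.2 [set x | a <= s.1 x] | s in A].

(* A Borel probability measure on [b - D, b] is encoded as one on the real    *)
(* line that gives this interval mass 1.                                      *)
Definition hoeffding_set (D1 D2 D3 : R) :
    set ((R * R * R -> R) * probability (R * R * R)%type R) :=
  [set s | s.1 = (fun x => x.1.1 + x.1.2 + x.2) /\
    (exists (b1 b2 b3 : R) (mu1 mu2 mu3 : probability R R),
       [/\ mu1 `[b1 - D1, b1]%classic = 1%E, mu2 `[b2 - D2, b2]%classic = 1%E,
           mu3 `[b3 - D3, b3]%classic = 1%E & s.2 = prob3 mu1 mu2 mu3]) /\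
    ('E_(s.2)[s.1] <= 0)%E].

Section McDiarmid.
Context {X1 X2 X3 : ptopologicalType}.

Local Notation X :=
  (borel_type X1 * borel_type X2 * borel_type X3)%type.

Implicit Type f : X -> R.

Definition osc1 f : \bar R :=
  ereal_sup [set ereal_sup [set (`|f x - f (x1', x.1.2, x.2)|)%:E
                           | x1' in [set: X1]] | x in [set: X]].

Definition osc2 f : \bar R :=
  ereal_sup [set ereal_sup [set (`|f x - f (x.1.1, x2', x.2)|)%:E
                           | x2' in [set: X2]] | x in [set: X]].

Definition osc3 f : \bar R :=
  ereal_sup [set ereal_sup [set (`|f x - f (x.1.1, x.1.2, x3')|)%:E
                           | x3' in [set: X3]] | x in [set: X]].

Definition bounded_osc (D1 D2 D3 : R) : set (X -> R) :=
  [set f | [/\ measurable_fun setT f, (osc1 f <= D1%:E)%E,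
               (osc2 f <= D2%:E)%E & (osc3 f <= D3%:E)%E]].

Definition mcdiarmid_set (D1 D2 D3 : R) : set ((X -> R) * probability X R) :=
  [set s | [/\ bounded_osc D1 D2 D3 s.1,
    (exists (mu1 : probability (borel_type X1) R)
            (mu2 : probability (borel_type X2) R)
            (mu3 : probability (borel_type X3) R), s.2 = prob3 mu1 mu2 mu3) &
    ('E_(s.2)[s.1] <= 0)%E]].

End McDiarmid.
End Uncertainty.

Section ExplicitBounds.
Context {R : realType}.
Variables (a D1 D2 D3 : R).

(* For D1 >= D2 >= D3 > 0 the ranges of [a] on which the four formulas hold   *)
(* are consecutive closed intervals and the formulas agree at the common      *)
(* endpoints, so testing them in this order gives the intended function.      *)
Definition F1 : R :=
  if D1 + D2 + D3 <= a then 0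
  else if D1 + D2 - 2 * D3 <= a then
    (D1 + D2 + D3 - a) ^+ 3 / (27 * D1 * D2 * D3)
  else if D1 - D2 <= a then (D1 + D2 - a) ^+ 2 / (4 * D1 * D2)
  else 1 - a / D1.

Definition psi (g : R) : R :=
  g ^+ 2 * (2 * (D2 / D3) - 1) - 2 * g * (3 * (D2 / D3) - 1)
  + g / (1 + g) * (8 * (D2 / D3) - 2 * (a / D3)).

Definition theta (g : R) : R :=
  1 - a / (D3 * (1 - g ^+ 2)) + D2 / D3 * ((1 - g) / (1 + g)).

Definition coefA : R := (5 * D2 - 2 * D3) / (2 * D2 - D3).
Definition coefB : R := (4 * D2 - a) / (2 * D2 - D3).

Definition cubic : {poly R[i]} :=
  (1 + 'X) ^+ 3 - (coefA%:C)%:P * (1 + 'X) ^+ 2 + (coefB%:C)%:P.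

(* The three complex roots of [cubic], listed with multiplicity; see          *)
(* [cubic_rootsE] and [size_cubic_roots].                                     *)
Definition cubic_roots : seq R[i] := sval (closed_field_poly_normal cubic).

Definition phi (z : R[i]) : R :=
  [&& complex.Im z == 0, 0 < complex.Re z < 1 & 0 < theta (complex.Re z) < 1]%:R.

(* [psi] only matters at real roots, where [phi] can be nonzero.              *)
Definition phi_psi (z : R[i]) : R := phi z * psi (complex.Re z).

Definition F2 : R :=
  Num.max (Num.max (phi_psi cubic_roots`_0) (phi_psi cubic_roots`_1))
          (phi_psi cubic_roots`_2).

Lemma size_lead_cubic : size cubic = 4%N /\ lead_coef cubic = 1.
Proof.
pose x := 'X - (-1)%:P : {poly R[i]}.
have xE : 1 + 'X = x by rewrite /x polyCN opprK addrC.
have lo : (size (- ((coefA%:C)%:P * x ^+ 2) + (coefB%:C)%:P)%R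
           < size (x ^+ 3)%R)%N.
  rewrite size_exp_XsubC (leq_ltn_trans (size_polyD _ _))// gtn_max size_polyN.
  rewrite mul_polyC (leq_ltn_trans (size_scale_leq _ _)) ?size_exp_XsubC//=.
  by rewrite (leq_ltn_trans (size_polyC_leq1 _)).
rewrite /cubic xE -addrA size_polyDl// lead_coefDl// size_exp_XsubC; split => //.
exact/monicP/monic_exp/monicXsubC.
Qed.

Lemma cubic_rootsE : cubic = \prod_(z <- cubic_roots) ('X - z%:P).
Proof.
have := svalP (closed_field_poly_normal cubic); rewrite -/cubic_roots.
by rewrite size_lead_cubic.2 scale1r.
Qed.

Lemma size_cubic_roots : size cubic_roots = 3%N.
Proof.
by have := size_lead_cubic.1; rewrite cubic_rootsE size_prod_XsubC => -[].
Qed.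

End ExplicitBounds.

(* Main.v *)
Require Import Defs.
From mathcomp Require Import all_boot all_order all_algebra.
From mathcomp Require Import all_classical all_reals all_analysis.
From mathcomp Require Import measurable_realfun complex ring lra.

(** In Hoeffding's problem as well as in McDiarmid's, replacing each marginal
    by a suitable probability with two atoms preserves the mean inequality and
    does not decrease the probability (in the plane, the mean of a random
    vector is dominated by a point of a segment joining two of its values).
    So [f] may be taken on the cube [{0,1}^3], with [C = {f >= a}]; as
    [a - f] is bounded by the weighted Hamming distance to [C], the question is
    how large [P(C)] can be when the mean distance to [C] is at least [a].

    If [C] is the corner [111], this means maximizing
    [(1 - q1) (1 - q2) (1 - q3)] under [D1 q1 + D2 q2 + D3 q3 >= a], and the
    maximum is [F1].  If every point is within [D1] of [C] then
    [P(C) <= 1 - a / D1 <= F1].  Otherwise, up to flipping coordinates, [000] is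
    at distance more than [D1], so [C] is a subset of [110, 101, 011, 111], and
    all these subsets but the full one again yield admissible [q1, q2, q3].

    For the remaining majority event, the first two marginals may be taken
    equal, to [(g, 1 - g)], and the last one is then [(theta g, 1 - theta g)]
    with success probability [psi g]: boundary cases are bounded by [F1], and
    [psi'] has the sign of the cubic polynomial that defines [F2].  For sums of
    independent variables the majority event never beats [F1], since
    [f(110), f(101), f(011) >= a] forces [f(111) >= a + max d_i], where [d_i] is
    the oscillation of the [i]-th term, and this slack pays for raising the
    probabilities enough to turn majority into a product.  Hence the optimal
    bounds are [F1] and [max F1 F2]. *)
Set Implicit Arguments.
Unset Strict Implicit.
Unset Printing Implicit Defensive.

Import Order.TTheory GRing.Theory Num.Theory.
Import numFieldNormedType.Exports.

Local Open Scope classical_set_scope.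
Local Open Scope ring_scope.

(** * The corner event *)

(** The difference of the two sides is three times the sum of the terms in [h1], [h2], [h3], plus
    half of the term in [h4]. *)
Lemma amgm3 (R : realFieldType) (x y z : R) : 0 <= x -> 0 <= y -> 0 <= z ->
  27 * (x * y * z) <= (x + y + z) ^+ 3.
Proof.
move=> x0 y0 z0.
have h1 := mulr_ge0 x0 (sqr_ge0 (y - z)).
have h2 := mulr_ge0 y0 (sqr_ge0 (x - z)).
have h3 := mulr_ge0 z0 (sqr_ge0 (x - y)).
have h4 := mulr_ge0 (addr_ge0 (addr_ge0 x0 y0) z0)
  (addr_ge0 (addr_ge0 (sqr_ge0 (x - y)) (sqr_ge0 (y - z))) (sqr_ge0 (x - z))).
by nra.
Qed.

(** In the variables [x], [y], [z] this maximizes [x * y * z] on a box under the budget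
    [x + y + z <= D1 + D2 + D3 - a]. In the branches of [F1], in order, the budget is nonpositive,
    no upper bound binds, [z = D3] binds, and [y = D2] binds as well. *)
Lemma prod_le_F1 (R : realType) (a D1 D2 D3 q1 q2 q3 : R) :
  0 <= a -> D2 <= D1 -> D3 <= D2 -> 0 < D3 ->
  0 <= q1 <= 1 -> 0 <= q2 <= 1 -> 0 <= q3 <= 1 ->
  a <= D1 * q1 + D2 * q2 + D3 * q3 ->
  (1 - q1) * (1 - q2) * (1 - q3) <= F1 a D1 D2 D3.
Proof.
move=> a0 D21 D32 D3_gt0 /andP[q10 q11] /andP[q20 q21] /andP[q30 q31] aq.
have D2_gt0 : 0 < D2 by lra.
have D1_gt0 : 0 < D1 by lra.
have D123 : 0 < D1 * D2 * D3 by rewrite !mulr_gt0 //.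
pose x := D1 * (1 - q1); pose y := D2 * (1 - q2); pose z := D3 * (1 - q3).
have x0 : 0 <= x by apply: mulr_ge0; [exact: ltW|rewrite subr_ge0].
have y0 : 0 <= y by apply: mulr_ge0; [exact: ltW|rewrite subr_ge0].
have z0 : 0 <= z by apply: mulr_ge0; [exact: ltW|rewrite subr_ge0].
have xD : x <= D1 by apply: ler_piMr; [exact: ltW|rewrite gerBl].
have yD : y <= D2 by apply: ler_piMr; [exact: ltW|rewrite gerBl].
have zD : z <= D3 by apply: ler_piMr; [exact: ltW|rewrite gerBl].
have T : x + y + z <= D1 + D2 + D3 - a by rewrite /x /y /z; lra.
have xyzE : (1 - q1) * (1 - q2) * (1 - q3) = (x * y * z) / (D1 * D2 * D3).
  by rewrite /x /y /z; field; rewrite !gt_eqF.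
rewrite xyzE ler_pdivrMr// /F1.
clearbody x y z; clear xyzE q10 q11 q20 q21 q30 q31 aq.
case: ifPn => [h|].
  have -> : x = 0 by lra.
  by rewrite !mul0r.
rewrite -ltNge => h1; case: ifPn => [h|].
  have -> : (D1 + D2 + D3 - a) ^+ 3 / (27 * D1 * D2 * D3) * (D1 * D2 * D3) =
    (D1 + D2 + D3 - a) ^+ 3 / 27 by field; rewrite !gt_eqF.
  rewrite ler_pdivlMr// mulrC.
  apply: le_trans (amgm3 x0 y0 z0) _.
  by rewrite lerXn2r// nnegrE; lra.
rewrite -ltNge => h2; case: ifPn => [h|].
  have -> : (D1 + D2 - a) ^+ 2 / (4 * D1 * D2) * (D1 * D2 * D3) =
    (D1 + D2 - a) ^+ 2 * D3 / 4 by field; rewrite !gt_eqF.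
  rewrite ler_pdivlMr//.
  set t := D1 + D2 + D3 - a in T.
  have -> : D1 + D2 - a = t - D3 by rewrite /t; ring.
  have tD : 3 * D3 < t by rewrite /t; lra.
  clearbody t.
  (* AM-GM in [x] and [y] for fixed [z]. As a function of [z], the result increases up to [t / 3],
     which exceeds [D3]; the product below is exactly its increment from [z] to [D3]. *)
  apply: (@le_trans _ _ (z * (t - z) ^+ 2)).
    have -> : x * y * z * 4 = z * (4 * (x * y)) by ring.
    apply: ler_wpM2l => //; apply: (@le_trans _ _ ((x + y) ^+ 2)).
      by have := sqr_ge0 (x - y); lra.
    by rewrite lerXn2r// ?nnegrE; lra.
  have : 0 <= (D3 - z) * ((t - (D3 + z) - D3) * (t - (D3 + z) + D3) +
                          D3 * (D3 - z)).
    apply: mulr_ge0; first by rewrite subr_ge0.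
    by apply: addr_ge0; apply: mulr_ge0; lra.
  by lra.
rewrite -ltNge => h3.
have -> : (1 - a / D1) * (D1 * D2 * D3) = (D1 - a) * D2 * D3.
  by field; rewrite gt_eqF.
set t := D1 + D2 + D3 - a in T.
have -> : D1 - a = t - D2 - D3 by rewrite /t; ring.
have tD : 2 * D2 + D3 < t by rewrite /t; lra.
clearbody t.
(* The three products add up to the required difference: spend the whole budget on [x], then raise
   [y] to [D2], then [z] to [D3]. *)
have : 0 <= (t - x - y - z) * (y * z) by rewrite !mulr_ge0//; lra.
have : 0 <= z * ((D2 - y) * (t - z - y - D2)) by rewrite !mulr_ge0//; lra.
have : 0 <= D2 * ((D3 - z) * (t - D2 - D3 - z)) by rewrite !mulr_ge0//; lra.
by lra.
Qed.

(** These are the maximizers for [prod_le_F1]. The alternative [F1 a D1 D2 D3 = 0] serves large [a],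
    where even [q1 = q2 = q3 = 1] may violate the constraint. *)
Lemma F1_attained (R : realType) (a D1 D2 D3 : R) :
  0 <= a -> D2 <= D1 -> D3 <= D2 -> 0 < D3 ->
  exists q1 q2 q3 : R,
  [/\ 0 <= q1 <= 1, 0 <= q2 <= 1, 0 <= q3 <= 1,
      a <= D1 * q1 + D2 * q2 + D3 * q3 \/ F1 a D1 D2 D3 = 0 &
      (1 - q1) * (1 - q2) * (1 - q3) = F1 a D1 D2 D3].
Proof.
move=> a0 D21 D32 D3_gt0.
have D2_gt0 : 0 < D2 by lra.
have D1_gt0 : 0 < D1 by lra.
have frac (x y : R) : 0 <= x -> 0 < y -> x <= y -> 0 <= 1 - x / y <= 1.
  move=> x0 y0 xy; apply/andP; split.
    by rewrite subr_ge0 ler_pdivrMr// mul1r.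
  by rewrite gerBl divr_ge0// ltW.
have DV (x y : R) : 0 < y -> y * (1 - x / y) = y - x.
  by move=> y0; field; rewrite gt_eqF.
rewrite /F1; case: ifPn => [h|].
  by exists 1, 1, 1; split; rewrite ?ler01 ?lexx ?subrr ?mulr0//; right.
rewrite -ltNge => h1; case: ifPn => [h|].
  (* The equality case of AM-GM: [u] is the common value of the three rescaled variables. In the
     next range only the first two are equal and [q3 = 0]. *)
  pose u := (D1 + D2 + D3 - a) / 3.
  have ? : 0 <= u by rewrite divr_ge0//; lra.
  have ? : u <= D3 by rewrite ler_pdivrMr//; lra.
  exists (1 - u / D1), (1 - u / D2), (1 - u / D3); split.
  - by apply: frac => //; lra.
  - by apply: frac => //; lra.
  - by apply: frac => //; lra.
  - by left; rewrite !DV// /u; lra.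
  - by rewrite /u; field; rewrite !gt_eqF.
rewrite -ltNge => h2; case: ifPn => [h|].
  pose u := (D1 + D2 - a) / 2.
  have ? : 0 <= u by rewrite divr_ge0//; lra.
  have ? : u <= D2 by rewrite ler_pdivrMr//; lra.
  exists (1 - u / D1), (1 - u / D2), 0; split.
  - by apply: frac => //; lra.
  - by apply: frac => //; lra.
  - by rewrite lexx ler01.
  - by left; rewrite !DV// /u; lra.
  - by rewrite /u; field; rewrite !gt_eqF.
rewrite -ltNge => h3.
exists (a / D1), 0, 0; split; rewrite ?lexx ?ler01//.
- apply/andP; split; first by apply: divr_ge0 => //; exact: ltW.
  by rewrite ler_pdivrMr// mul1r; lra.
- by left; rewrite mulrCA divff ?gt_eqF// mulr1 !mulr0 !addr0.
- by ring.
Qed.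

Lemma F1_ge0 (R : realType) (a D1 D2 D3 : R) :
  0 <= a -> D2 <= D1 -> D3 <= D2 -> 0 < D3 -> 0 <= F1 a D1 D2 D3.
Proof.
move=> a0 D21 D32 D3_gt0.
have [q1 [q2 [q3 [/andP[_ ?] /andP[_ ?] /andP[_ ?] _ <-]]]] :=
  F1_attained a0 D21 D32 D3_gt0.
by rewrite !mulr_ge0// subr_ge0.
Qed.

(** * Functions on the cube *)

Definition mix (R : pzRingType) (p u v : R) : R := p * u + (1 - p) * v.

Definition cube_mean (R : pzRingType) (p1 p2 p3 : R)
    (g : bool -> bool -> bool -> R) : R :=
  mix p1 (mix p2 (mix p3 (g true true true) (g true true false))
                 (mix p3 (g true false true) (g true false false)))
         (mix p2 (mix p3 (g false true true) (g false true false))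
                 (mix p3 (g false false true) (g false false false))).

Lemma le_mix (R : realDomainType) (p u v u' v' : R) :
  0 <= p <= 1 -> u <= u' -> v <= v' -> mix p u v <= mix p u' v'.
Proof.
by move=> /andP[p0 p1] uu vv; rewrite lerD// ler_wpM2l// subr_ge0.
Qed.

Section Cube.
Variables (R : realType).
Implicit Types (p a D : R) (g F : bool -> bool -> bool -> R).

Lemma le_cube_mean p1 p2 p3 g g' :
  0 <= p1 <= 1 -> 0 <= p2 <= 1 -> 0 <= p3 <= 1 ->
  (forall b1 b2 b3, g b1 b2 b3 <= g' b1 b2 b3) ->
  cube_mean p1 p2 p3 g <= cube_mean p1 p2 p3 g'.
Proof. by move=> h1 h2 h3 gg'; do !apply: le_mix. Qed.

Definition cube_freq p1 p2 p3 (n : bool -> bool -> bool -> bool) : R :=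
  cube_mean p1 p2 p3 (fun b1 b2 b3 => (n b1 b2 b3)%:R).

Lemma cube_freq_itv p1 p2 p3 (n : bool -> bool -> bool -> bool) :
  0 <= p1 <= 1 -> 0 <= p2 <= 1 -> 0 <= p3 <= 1 ->
  0 <= cube_freq p1 p2 p3 n <= 1.
Proof.
move=> h1 h2 h3; apply/andP; split.
  rewrite (_ : 0 = cube_mean p1 p2 p3 (fun _ _ _ => 0)).
    by apply: le_cube_mean => // *; rewrite ler0n.
  by rewrite /cube_mean /mix; ring.
rewrite [leRHS](_ : _ = cube_mean p1 p2 p3 (fun _ _ _ => 1)).
  by apply: le_cube_mean => // *; rewrite lern1 leq_b1.
by rewrite /cube_mean /mix; ring.
Qed.

(** Both orders of the two values are quantified, so these one-sided bounds also bound the absolute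
    values. *)
Definition cube_osc D1 D2 D3 F :=
  [/\ forall b1 b1' b2 b3, F b1 b2 b3 - F b1' b2 b3 <= D1,
      forall b1 b2 b2' b3, F b1 b2 b3 - F b1 b2' b3 <= D2 &
      forall b1 b2 b3 b3', F b1 b2 b3 - F b1 b2 b3' <= D3].

Definition cube_prob p1 p2 p3 a F :=
  cube_freq p1 p2 p3 (fun b1 b2 b3 => a <= F b1 b2 b3).

Lemma cube_dist a D1 D2 D3 F b1 b2 b3 c1 c2 c3 :
  cube_osc D1 D2 D3 F -> a <= F c1 c2 c3 ->
  a <= F b1 b2 b3 + (D1 * (b1 != c1)%:R + D2 * (b2 != c2)%:R +
                     D3 * (b3 != c3)%:R).
Proof.
move=> [osc1F osc2F osc3F] aF.
have h1 : F c1 b2 b3 - F b1 b2 b3 <= D1 * (b1 != c1)%:R.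
  by case: eqVneq => [->|_]; rewrite ?subrr ?mulr0 ?mulr1.
have h2 : F c1 c2 b3 - F c1 b2 b3 <= D2 * (b2 != c2)%:R.
  by case: eqVneq => [->|_]; rewrite ?subrr ?mulr0 ?mulr1.
have h3 : F c1 c2 c3 - F c1 c2 b3 <= D3 * (b3 != c3)%:R.
  by case: eqVneq => [->|_]; rewrite ?subrr ?mulr0 ?mulr1.
by lra.
Qed.

(* As [D1 >= D2 >= D3 >= 0], dominating the partial sums of the weights      *)
(* dominates the weighted Hamming distance.                                   *)
Definition covers (n1 n2 n3 : bool -> bool -> bool -> bool) b1 b2 b3
    (c : bool * bool * bool) :=
  let: (x1, x2, x3) := (b1 != c.1.1, b2 != c.1.2, b3 != c.2) in
  let: (y1, y2, y3) := (n1 b1 b2 b3, n2 b1 b2 b3, n3 b1 b2 b3) in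
  [&& x1 <= y1, x1 + x2 <= y1 + y2 & x1 + x2 + x3 <= y1 + y2 + y3]%N.

(** At each vertex, [n1], [n2], [n3] say which weights are charged for reaching some point of [C];
    hence [a - F] is at most the charge, and taking means gives the constraint of [prod_le_F1]. *)
Lemma cube_cover a D1 D2 D3 p1 p2 p3 F (C : seq (bool * bool * bool))
    (n1 n2 n3 : bool -> bool -> bool -> bool) :
  D2 <= D1 -> D3 <= D2 -> 0 < D3 ->
  0 <= p1 <= 1 -> 0 <= p2 <= 1 -> 0 <= p3 <= 1 ->
  cube_osc D1 D2 D3 F -> cube_mean p1 p2 p3 F <= 0 ->
  all (fun c => a <= F c.1.1 c.1.2 c.2) C ->
  (forall b1 b2 b3, has (covers n1 n2 n3 b1 b2 b3) C) ->
  a <= D1 * cube_freq p1 p2 p3 n1 + D2 * cube_freq p1 p2 p3 n2 +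
       D3 * cube_freq p1 p2 p3 n3.
Proof.
move=> D21 D32 D3_gt0 h1 h2 h3 oscF F0 /allP aC covC.
have aF b1 b2 b3 : a <= F b1 b2 b3 + (D1 * (n1 b1 b2 b3)%:R +
     D2 * (n2 b1 b2 b3)%:R + D3 * (n3 b1 b2 b3)%:R).
  have /hasP[[[c1 c2] c3] /aC/= aFc] := covC b1 b2 b3.
  have {aFc} := cube_dist b1 b2 b3 oscF aFc.
  move: (F b1 b2 b3) => v; rewrite /covers /=.
  move: (b1 != c1) (b2 != c2) (b3 != c3) (n1 b1 b2 b3) (n2 b1 b2 b3)
    (n3 b1 b2 b3) => x1 x2 x3 y1 y2 y3 av.
  rewrite -!(ler_nat R) !natrD => /and3P[k1 k2 k3].
  (* Summation by parts: the three products add up to the charge minus the weighted distance to the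
     chosen point. *)
  have : 0 <= (D1 - D2) * (y1%:R - x1%:R) by rewrite mulr_ge0 ?subr_ge0.
  have : 0 <= (D2 - D3) * (y1%:R + y2%:R - x1%:R - x2%:R).
    by rewrite mulr_ge0//; lra.
  have : 0 <= D3 * (y1%:R + y2%:R + y3%:R - x1%:R - x2%:R - x3%:R).
    by rewrite mulr_ge0//; lra.
  by clear -av; lra.
have := le_cube_mean h1 h2 h3 aF.
by clear -F0; rewrite /cube_freq /cube_mean /mix in F0 *; lra.
Qed.

Lemma F1_cube a D1 D2 D3 p1 p2 p3 F (C : seq (bool * bool * bool))
    (n1 n2 n3 : bool -> bool -> bool -> bool) :
  0 <= a -> D2 <= D1 -> D3 <= D2 -> 0 < D3 ->
  0 <= p1 <= 1 -> 0 <= p2 <= 1 -> 0 <= p3 <= 1 ->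
  cube_osc D1 D2 D3 F -> cube_mean p1 p2 p3 F <= 0 ->
  all (fun c => a <= F c.1.1 c.1.2 c.2) C ->
  (forall b1 b2 b3, has (covers n1 n2 n3 b1 b2 b3) C) ->
  (1 - cube_freq p1 p2 p3 n1) * (1 - cube_freq p1 p2 p3 n2) *
    (1 - cube_freq p1 p2 p3 n3) <= F1 a D1 D2 D3.
Proof.
move=> a0 D21 D32 D3_gt0 h1 h2 h3 oscF F0 aC covC.
apply: prod_le_F1 => //; try exact: cube_freq_itv.
exact: (@cube_cover _ _ _ _ _ _ _ F C).
Qed.

(* Bounds the probability that exactly two of three independent events occur:
   [p] is the largest of the three probabilities. *)
Lemma pivot_ineq (p x y r : R) :
  0 <= p <= 1 -> 0 <= x <= p -> 0 <= y <= p ->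
  r = (1 - x) * (1 - y) ->
  p * (1 - r) + x * y * (1 - 2 * p) <=
  (1 - r / 2) * (1 - r / 2) * (p + x * y * (1 - 2 * p)).
Proof.
move=> /andP[p0 p1] /andP[x0 xp] /andP[y0 yp] rE.
have r0 : 0 <= r by rewrite rE mulr_ge0//; lra.
have r1 : r <= 1 by rewrite rE -[leRHS]mulr1 ler_pM//; lra.
have rp : (1 - p) ^+ 2 <= r by rewrite rE expr2 ler_pM//; lra.
have xyp : x * y <= p ^+ 2 by rewrite expr2 ler_pM.
have xy0 : 0 <= x * y by rewrite mulr_ge0.
set s := x * y in xyp xy0 *; clearbody s; clear rE.
(* The difference of the two sides of the goal is [r / 4] times the difference of the two sides
   here. *)
suff : s * (1 - 2 * p) * (4 - r) <= p * r.
  by move=> h; have := ler_wpM2l r0 h; lra.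
have [hp|hp] := lerP 1 (2 * p).
  have : 0 <= s * (2 * p - 1) * (4 - r) by rewrite !mulr_ge0//; lra.
  by have := mulr_ge0 p0 r0; lra.
(* The worst case is [x = y = p], that is [s = p ^+ 2] and [r = (1 - p) ^+ 2], which leaves a
   polynomial in [p] alone. *)
have h1 : s * (1 - 2 * p) * (4 - r) <=
    p ^+ 2 * (1 - 2 * p) * (4 - (1 - p) ^+ 2).
  apply: ler_pM; rewrite ?mulr_ge0//; try lra.
  by rewrite ler_wpM2r//; lra.
have h2 : p * (1 - p) ^+ 2 <= p * r by rewrite ler_wpM2l.
suff : 0 <= p * (1 - 5 * p + 5 * p ^+ 2 + 5 * p ^+ 3 - 2 * p ^+ 4) by lra.
rewrite mulr_ge0//.
(* On [[0, 1/2]] the quartic is smallest near [7 / 20], with value about 0.047. It is the term in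
   [p ^+ 3] below, plus four times this one, plus five times the square of [p - 353 / 1000], plus a
   positive constant. *)
have : 0 <= (p - 7 / 20) ^+ 2 * (p + 7 / 10).
  by rewrite mulr_ge0 ?sqr_ge0//; lra.
have : 0 <= p ^+ 3 * (1 - 2 * p) by rewrite mulr_ge0 ?exprn_ge0//; lra.
have := sqr_ge0 (p - 353 / 1000); lra.
Qed.

(** The most probable coordinate is the pivot: changing at most this one reaches the event, unless
    the other two both fail, when one of them must also change. [key] splits the frequency of that
    second charge evenly between the other two weights, which does not lower the total as
    [D'' <= D'], and [pivot_ineq] compares the resulting product with the probability. *)
Lemma F1_triple a D1 D2 D3 p1 p2 p3 F :
  0 <= a -> D2 <= D1 -> D3 <= D2 -> 0 < D3 ->
  0 <= p1 <= 1 -> 0 <= p2 <= 1 -> 0 <= p3 <= 1 ->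
  cube_osc D1 D2 D3 F -> cube_mean p1 p2 p3 F <= 0 ->
  a <= F true true false -> a <= F true false true -> a <= F false true true ->
  p1 * p2 * (1 - p3) + p1 * (1 - p2) * p3 + (1 - p1) * p2 * p3 <=
  F1 a D1 D2 D3.
Proof.
move=> a0 D21 D32 D3_gt0 h1 h2 h3 oscF F0 F110 F101 F011.
have cov n1 n2 n3 := @cube_cover a D1 D2 D3 p1 p2 p3 F
  [:: (true, true, false); (true, false, true); (false, true, true)]
  n1 n2 n3 D21 D32 D3_gt0 h1 h2 h3 oscF F0.
rewrite /= F110 F101 F011 in cov.
have /andP[p10 p11] := h1; have /andP[p20 p21] := h2.
have /andP[p30 p31] := h3.
have half (x y : R) : 0 <= x <= 1 -> 0 <= y <= 1 ->
    0 <= (1 - x) * (1 - y) / 2 <= 1.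
  move=> /andP[x0 x1] /andP[y0 y1]; apply/andP; split.
    by apply: divr_ge0 => //; apply: mulr_ge0; lra.
  rewrite ler_pdivrMr// mul1r -[2]mulr1; apply: ler_pM; lra.
have key p x y D D' D'' : 0 <= p <= 1 -> 0 <= x <= p -> 0 <= y <= p ->
    D'' <= D' -> 
    0 <= 1 - (p + x * y * (1 - 2 * p)) <= 1 ->
    (forall q q' q'', 0 <= q <= 1 -> 0 <= q' <= 1 -> 0 <= q'' <= 1 ->
      a <= D * q + D' * q' + D'' * q'' ->
      (1 - q) * (1 - q') * (1 - q'') <= F1 a D1 D2 D3) ->
    a <= D * (1 - (p + x * y * (1 - 2 * p))) + D'' * ((1 - x) * (1 - y)) ->
    p * (1 - (1 - x) * (1 - y)) + x * y * (1 - 2 * p) <= F1 a D1 D2 D3.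
  move=> hp /andP[x0 xp] /andP[y0 yp] D'D q01 le_F1 aq.
  have /andP[p0 p1'] := hp.
  have r01 : 0 <= (1 - x) * (1 - y) / 2 <= 1 by apply: half; lra.
  apply: (le_trans (@pivot_ineq p x y _ hp _ _ erefl)); rewrite ?x0 ?y0//.
  have : a <= D * (1 - (p + x * y * (1 - 2 * p))) +
      D' * ((1 - x) * (1 - y) / 2) + D'' * ((1 - x) * (1 - y) / 2).
    have /andP[r0 _] := r01.
    have := ler_wpM2r r0 D'D; lra.
  by move=> /(le_F1 _ _ _ q01 r01 r01); lra.
have up := fun q1 q2 q3 => @prod_le_F1 R a D1 D2 D3 q1 q2 q3 a0 D21 D32 D3_gt0.
have [/andP[? ?]|m1] := boolP ((p2 <= p1) && (p3 <= p1)).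
  pose n b1 b2 b3 := if b2 && b3 then b1 else ~~ b1.
  have nE : cube_freq p1 p2 p3 n = 1 - (p1 + p2 * p3 * (1 - 2 * p1)).
    by rewrite /cube_freq /cube_mean /mix /=; ring.
  have := cov n (fun _ _ _ => false) (fun _ b2 b3 => ~~ b2 && ~~ b3).
  have := cube_freq_itv n h1 h2 h3; rewrite nE.
  rewrite /cube_freq /cube_mean /mix /= => q1 /(_ isT ltac:(by do 3!case)) aq.
  have := @key p1 p2 p3 D1 D2 D3 h1 _ _ _ q1 _ _; rewrite p20 p30.
  move=> h; apply: le_trans (h _ _ _ _ _) => //; first by clear; lra.
  by clear -aq; lra.
have [/andP[? ?]|m2] := boolP ((p1 <= p2) && (p3 <= p2)).
  pose n b1 b2 b3 := if b1 && b3 then b2 else ~~ b2.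
  have nE : cube_freq p1 p2 p3 n = 1 - (p2 + p1 * p3 * (1 - 2 * p2)).
    by rewrite /cube_freq /cube_mean /mix /=; ring.
  have := cov (fun _ _ _ => false) n (fun b1 _ b3 => ~~ b1 && ~~ b3).
  have := cube_freq_itv n h1 h2 h3; rewrite nE.
  rewrite /cube_freq /cube_mean /mix /= => q2 /(_ isT ltac:(by do 3!case)) aq.
  have := @key p2 p1 p3 D2 D1 D3 h2 _ _ _ q2 _ _; rewrite p10 p30.
  move=> h; apply: le_trans (h _ _ _ _ _) => //; first by clear; lra.
  - by lra.
  - by move=> q q' q'' *; have := up q' q q''; lra.
  - by clear -aq; lra.
have [p13 p23] : p1 <= p3 /\ p2 <= p3.
  by move: m1 m2; rewrite !negb_and -!ltNge => /orP[] ? /orP[] ?; split; lra.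
pose n b1 b2 b3 := if b1 && b2 then b3 else ~~ b3.
have nE : cube_freq p1 p2 p3 n = 1 - (p3 + p1 * p2 * (1 - 2 * p3)).
  by rewrite /cube_freq /cube_mean /mix /=; ring.
have := cov (fun _ _ _ => false) (fun b1 b2 _ => ~~ b1 && ~~ b2) n.
have := cube_freq_itv n h1 h2 h3; rewrite nE.
rewrite /cube_freq /cube_mean /mix /= => q3 /(_ isT ltac:(by do 3!case)) aq.
have := @key p3 p1 p2 D3 D1 D2 h3 _ _ _ q3 _ _; rewrite p10 p20.
move=> h; apply: le_trans (h _ _ _ _ _) => //; first by clear; lra.
- by move=> q q' q'' *; have := up q' q'' q; lra.
- by clear -aq; lra.
Qed.

Ltac F1_cover dom C n1 n2 n3 :=
  left; apply: le_trans (dom C n1 n2 n3 _ _);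
  [by clear; rewrite /cube_freq /cube_mean /mix /=; lra
  |by rewrite /= ?andbT; do ?[apply/andP; split]
  |by do 3!case].

(** One flip gains at most [D1], so all vertices with at most one [true] fail; this leaves the
    sixteen subsets of the majority event. *)
Lemma cube_corner a D1 D2 D3 p1 p2 p3 F :
  0 <= a -> D2 <= D1 -> D3 <= D2 -> 0 < D3 ->
  0 <= p1 <= 1 -> 0 <= p2 <= 1 -> 0 <= p3 <= 1 ->
  cube_osc D1 D2 D3 F -> cube_mean p1 p2 p3 F <= 0 ->
  F false false false < a - D1 ->
  cube_prob p1 p2 p3 a F <= F1 a D1 D2 D3 \/
  [/\ a <= F true true true, a <= F true true false, a <= F true false true &
      a <= F false true true].
Proof.
move=> a0 D21 D32 D3_gt0 h1 h2 h3 oscF F0 F000.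
have [osc1F osc2F osc3F] := oscF.
have F100 : F true false false < a by have := osc1F true false false false; lra.
have F010 : F false true false < a by have := osc2F false true false false; lra.
have F001 : F false false true < a by have := osc3F false false true false; lra.
have F000' : F false false false < a by lra.
have dom C n1 n2 n3 :=
  @F1_cube a D1 D2 D3 p1 p2 p3 F C n1 n2 n3 a0 D21 D32 D3_gt0 h1 h2 h3 oscF F0.
have F1p := F1_ge0 a0 D21 D32 D3_gt0.
rewrite /cube_prob {1}/cube_freq {1}/cube_mean.
rewrite (lt_geF F100) (lt_geF F010) (lt_geF F001) (lt_geF F000').
case: (lerP a (F true true true)) => [F111|F111];
  case: (lerP a (F true true false)) => [F110|F110];
  case: (lerP a (F true false true)) => [F101|F101];
  case: (lerP a (F false true true)) => [F011|F011].
- by right.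
(* Each event given to [F1_cover] is an intersection of conditions on disjoint groups of
   coordinates, so its probability is exactly the product. A violated condition is repaired by one
   flip, charged to the cheapest coordinate of its group. *)
- F1_cover dom [:: (true, true, true); (true, true, false); (true, false, true)]
    (fun b1 b2 b3 : bool => ~~ b1) (fun b1 b2 b3 : bool => false)
    (fun b1 b2 b3 : bool => ~~ b2 && ~~ b3).
- F1_cover dom [:: (true, true, true); (true, true, false); (false, true, true)]
    (fun b1 b2 b3 : bool => false) (fun b1 b2 b3 : bool => ~~ b2)
    (fun b1 b2 b3 : bool => ~~ b1 && ~~ b3).
- F1_cover dom [:: (true, true, true); (true, true, false)]
    (fun b1 b2 b3 : bool => ~~ b1) (fun b1 b2 b3 : bool => ~~ b2)
    (fun b1 b2 b3 : bool => false).
- F1_cover dom [:: (true, true, true); (true, false, true); (false, true, true)]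
    (fun b1 b2 b3 : bool => false) (fun b1 b2 b3 : bool => ~~ b1 && ~~ b2)
    (fun b1 b2 b3 : bool => ~~ b3).
- F1_cover dom [:: (true, true, true); (true, false, true)]
    (fun b1 b2 b3 : bool => ~~ b1) (fun b1 b2 b3 : bool => false)
    (fun b1 b2 b3 : bool => ~~ b3).
- F1_cover dom [:: (true, true, true); (false, true, true)]
    (fun b1 b2 b3 : bool => false) (fun b1 b2 b3 : bool => ~~ b2)
    (fun b1 b2 b3 : bool => ~~ b3).
- F1_cover dom [:: (true, true, true)]
    (fun b1 b2 b3 : bool => ~~ b1) (fun b1 b2 b3 : bool => ~~ b2)
    (fun b1 b2 b3 : bool => ~~ b3).
- left; have := F1_triple a0 D21 D32 D3_gt0 h1 h2 h3 oscF F0 F110 F101 F011.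
  by apply: le_trans; clear; rewrite /mix /=; lra.
- F1_cover dom [:: (true, true, false); (true, false, true)]
    (fun b1 b2 b3 : bool => ~~ b1) (fun b1 b2 b3 : bool => false)
    (fun b1 b2 b3 : bool => b2 == b3).
- F1_cover dom [:: (true, true, false); (false, true, true)]
    (fun b1 b2 b3 : bool => false) (fun b1 b2 b3 : bool => ~~ b2)
    (fun b1 b2 b3 : bool => b1 == b3).
- F1_cover dom [:: (true, true, false)]
    (fun b1 b2 b3 : bool => ~~ b1) (fun b1 b2 b3 : bool => ~~ b2)
    (fun b1 b2 b3 : bool => b3).
- F1_cover dom [:: (true, false, true); (false, true, true)]
    (fun b1 b2 b3 : bool => false) (fun b1 b2 b3 : bool => b1 == b2)
    (fun b1 b2 b3 : bool => ~~ b3).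
- F1_cover dom [:: (true, false, true)]
    (fun b1 b2 b3 : bool => ~~ b1) (fun b1 b2 b3 : bool => b2)
    (fun b1 b2 b3 : bool => ~~ b3).
- F1_cover dom [:: (false, true, true)]
    (fun b1 b2 b3 : bool => b1) (fun b1 b2 b3 : bool => ~~ b2)
    (fun b1 b2 b3 : bool => ~~ b3).
- by left; rewrite /cube_freq /cube_mean /mix !(mulr0, addr0).
Qed.

End Cube.

(** * The majority event *)

(** For independent events this is the probability that at least two of three occur: the first two,
    or exactly one of them and the third. *)
Definition majority (R : pzRingType) (p1 p2 p3 : R) : R :=
  p1 * p2 + p3 * (p1 + p2 - 2 * (p1 * p2)).

Section Majority.
Variable R : realType.
Implicit Types a D p : R.

Lemma majority_le1 p1 p2 p3 :
  0 <= p1 <= 1 -> 0 <= p2 <= 1 -> 0 <= p3 <= 1 -> majority p1 p2 p3 <= 1.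
Proof.
move=> /andP[p10 p11] /andP[p20 p21] /andP[p30 p31]; rewrite /majority.
have := mulr_ge0 p10 p20.
have h : 0 <= (1 - p1) * (1 - p2) by rewrite mulr_ge0 ?subr_ge0.
have : 0 <= (1 - p1) * p2 by rewrite mulr_ge0 ?subr_ge0.
have : 0 <= (1 - p2) * p1 by rewrite mulr_ge0 ?subr_ge0.
move=> k1 k2 _.
have : 0 <= (1 - p3) * ((1 - p1) * p2 + (1 - p2) * p1).
  by rewrite mulr_ge0 ?subr_ge0// addr_ge0.
by lra.
Qed.

(** The preserved quantity is the mean charge for reaching the majority event. The intermediate
    value theorem gives [g], and the gain in probability, times [D2], is [(g * g - p1 * p2) * ((1 -
    p3) * (D2 - p3 * D3))]. *)
Lemma majority_sym D2 D3 p1 p2 p3 :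
  D3 <= D2 -> 0 < D3 ->
  0 <= p1 <= 1 -> 0 <= p2 <= 1 -> 0 <= p3 <= 1 ->
  exists g, [/\ 0 <= g <= 1,
    D3 * (1 - p3) * (1 - p1 * p2) + D2 * ((1 - p1) * (1 - p2)) =
    D3 * (1 - p3) * (1 - g * g) + D2 * ((1 - g) * (1 - g)) &
    majority p1 p2 p3 <= majority g g p3].
Proof.
move=> D32 D3_gt0 /andP[p10 p11] /andP[p20 p21] /andP[p30 p31].
have D2_gt0 : 0 < D2 by lra.
pose f g := D3 * (1 - p3) * (1 - g * g) + D2 * ((1 - g) * (1 - g)).
pose e := D3 * (1 - p3) * (1 - p1 * p2) + D2 * ((1 - p1) * (1 - p2)).
have cf : {within `[0, 1], continuous f}.
  apply: continuous_subspaceT => x.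
  rewrite /f; apply: cvgD; apply: cvgM; try exact: cvg_cst.
    by apply: cvgB; [exact: cvg_cst|apply: cvgM; exact: cvg_id].
  by apply: cvgM; apply: cvgB; try exact: cvg_cst; exact: cvg_id.
have Dq : 0 <= D3 * (1 - p3) by apply: mulr_ge0; lra.
have DqD : D3 * (1 - p3) <= D2.
  by apply: (@le_trans _ _ D3) => //; rewrite ler_piMr; lra.
have p12 : 0 <= p1 * p2 by rewrite mulr_ge0.
have p12' : p1 * p2 <= 1 by rewrite -[1]mulr1 ler_pM.
have q12 : 0 <= (1 - p1) * (1 - p2) by apply: mulr_ge0; lra.
have q12' : (1 - p1) * (1 - p2) <= 1.
  by rewrite -[leRHS]mulr1; apply: ler_pM; lra.
have : Num.min (f 0) (f 1) <= e <= Num.max (f 0) (f 1).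
  rewrite ge_min le_max; apply/andP; split; apply/orP; [right|left].
    rewrite /f /e !(mulr1, subrr, mulr0, addr0).
    by apply: addr_ge0; apply: mulr_ge0; lra.
  rewrite /f /e mulr0 subr0 !mulr1.
  have := mulr_ge0 Dq p12; have := ler_wpM2l (ltW D2_gt0) q12'; lra.
move=> /(IVT ler01 cf)[g]; rewrite in_itv/= => /andP[g0 g1] fg.
exists g; split; rewrite ?g0 ?g1//.
move: fg; rewrite /f /e.
move: Dq DqD; set K := D3 * (1 - p3) => K0 KD fg.
(* For fixed [p3], the constraint and the majority probability are affine in
   [(p1 + p2, p1 * p2)]. *)
have gp : p1 * p2 <= g * g.
  rewrite leNgt; apply/negP => gp.
  have : (g + g) ^+ 2 < (p1 + p2) ^+ 2.
    by have := sqr_ge0 (p1 - p2); lra.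
  rewrite ltr_pXn2r// ?nnegrE ?addr_ge0// => gp'.
  (* Eliminating [p1 * p2] through [fg] factors this difference; its second factor is negative
     because [p1 + p2 + (g + g) < 4]. *)
  have h1 : 0 <= (D2 - K) * ((p1 + p2) ^+ 2 - 4 * (p1 * p2)).
    by apply: mulr_ge0; [lra|have := sqr_ge0 (p1 - p2); lra].
  have {h1} : 0 <= (p1 + p2 - (g + g)) *
      ((D2 - K) * (p1 + p2 + (g + g)) - 4 * D2) by lra.
  rewrite pmulr_rge0; last lra.
  have g_lt1 : g < 1.
    rewrite ltNge; apply/negP => g1'.
    by have := ler_pM ler01 ler01 g1' g1'; lra.
  have : (D2 - K) * (p1 + p2 + (g + g)) <= D2 * (p1 + p2 + (g + g)).
    by apply: ler_wpM2r; lra.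
  have : 0 < D2 * (4 - (p1 + p2 + (g + g))) by apply: mulr_gt0; lra.
  by lra.
have E : D2 * (2 * g - p1 - p2) = (D2 - K) * (g * g - p1 * p2) by lra.
rewrite /majority -subr_ge0 -(pmulr_rge0 _ D2_gt0).
have -> : D2 * (g * g + p3 * (g + g - 2 * (g * g)) -
    (p1 * p2 + p3 * (p1 + p2 - 2 * (p1 * p2)))) =
  (g * g - p1 * p2) * (D2 * (1 - 2 * p3)) +
  p3 * (D2 * (2 * g - p1 - p2)) by ring.
rewrite E.
have -> : (g * g - p1 * p2) * (D2 * (1 - 2 * p3)) +
    p3 * ((D2 - K) * (g * g - p1 * p2)) =
  (g * g - p1 * p2) * ((1 - p3) * (D2 - p3 * D3)) by rewrite /K; ring.
apply: mulr_ge0; first lra.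
apply: mulr_ge0; first lra.
by rewrite subr_ge0 (le_trans _ D32)// ler_piMl// ltW.
Qed.

Lemma phi_psi_root a D2 D3 (g : R) :
  (1 + g) ^+ 3 - coefA D2 D3 * (1 + g) ^+ 2 + Defs.coefB a D2 D3 = 0 ->
  phi_psi a D2 D3 g%:C%C <= F2 a D2 D3.
Proof.
move=> g_root.
have : g%:C%C \in cubic_roots a D2 D3.
  rewrite -root_prod_XsubC -cubic_rootsE /root /cubic.
  rewrite 2!hornerD hornerN horner_exp hornerM horner_exp.
  rewrite hornerD !hornerC hornerX.
  move: g_root; move: (coefA D2 D3) (Defs.coefB a D2 D3) => A B g_root.
  have -> : 1 + g%:C%C = (1 + g)%:C%C.
    by rewrite [RHS](rmorphD (real_complex R)).
  rewrite -!(rmorphXn (real_complex R)) -!(rmorphM (real_complex R)).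
  rewrite -!(rmorphN (real_complex R)) -!(rmorphD (real_complex R)).
  by rewrite g_root.
have := size_cubic_roots a D2 D3; rewrite /F2.
case: (cubic_roots a D2 D3) => [|z1 [|z2 [|z3 []]]]//= _.
rewrite !inE !le_max => /or3P[] /eqP->; rewrite lexx ?orbT//.
Qed.


(** The right-hand side is [majority g g (theta a D2 D3 g)], which is where the formula for [psi]
    comes from. *)
Lemma psiE a D2 D3 g : 0 < D3 -> 0 <= g < 1 ->
  psi a D2 D3 g = g * g + theta a D2 D3 g * (2 * g * (1 - g)).
Proof.
move=> D3_gt0 /andP[g0 g1]; rewrite /psi /theta; field.
by rewrite !gt_eqF//; try nra.
Qed.

(** This identifies [theta] as the third probability for which the mean charge is exactly [a]. *)
Lemma thetaE a D2 D3 g : 0 < D3 -> 0 <= g < 1 ->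
  theta a D2 D3 g * (D3 * (1 - g ^+ 2)) =
  D3 * (1 - g ^+ 2) + D2 * (1 - g) ^+ 2 - a.
Proof.
move=> D3_gt0 /andP[g0 g1].
have -> : 1 - g ^+ 2 = (1 - g) * (1 + g) by ring.
by rewrite /theta; field; rewrite !gt_eqF//; nra.
Qed.

(** The first factor is positive, so the critical points of [psi] are the real roots of the
    cubic. *)
Lemma is_derive_psi a D2 D3 (g : R) : 0 < D3 -> D3 <= D2 -> 0 <= g ->
  is_derive g 1 (psi a D2 D3) (2 * (2 * D2 - D3) / (D3 * (1 + g) ^+ 2) *
    ((1 + g) ^+ 3 - coefA D2 D3 * (1 + g) ^+ 2 + Defs.coefB a D2 D3)).
Proof.
move=> D3_gt0 D32 g0.
have g1 : 1 + g != 0 by rewrite gt_eqF//; lra.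
rewrite /psi.
apply: is_derive_eq.
rewrite /GRing.scale/= /coefA /Defs.coefB; field.
by rewrite !gt_eqF//; lra.
Qed.

Lemma majority_le a D1 D2 D3 p1 p2 p3 :
  0 <= a -> D2 <= D1 -> D3 <= D2 -> 0 < D3 ->
  0 <= p1 <= 1 -> 0 <= p2 <= 1 -> 0 <= p3 <= 1 ->
  a <= D3 * (1 - p3) * (1 - p1 * p2) + D2 * ((1 - p1) * (1 - p2)) ->
  majority p1 p2 p3 <= Num.max (F1 a D1 D2 D3) (F2 a D2 D3).
Proof.
move=> a0 D21 D32 D3_gt0 h1 h2 h3 ap.
have [g0 [/andP[g00 g01] eE Pg]] := majority_sym D32 D3_gt0 h1 h2 h3.
rewrite {}eE in ap; apply: (le_trans Pg) => {Pg h1 h2 p1 p2}.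
have /andP[p30 p31] := h3.
have D2_gt0 : 0 < D2 by lra.
have up q1 q2 q3 := @prod_le_F1 R a D1 D2 D3 q1 q2 q3 a0 D21 D32 D3_gt0.
rewrite le_max.
(* For [a = 0], [F1] is at least 1. A positive [a] keeps [g = 1], where [theta] degenerates, out of
   the set [S] below. *)
have [->|a_neq0] := eqVneq a 0.
  apply/orP; left; apply: (@le_trans _ _ 1).
    by apply: majority_le1 => //; rewrite g00.
  have := @prod_le_F1 R 0 D1 D2 D3 0 0 0 (lexx _) D21 D32 D3_gt0.
  by rewrite !subr0 !mulr1 !mulr0 !addr0 lexx ler01; apply.
have {a0 a_neq0} a_gt0 : 0 < a by rewrite lt_def a_neq0.
(* This is the majority probability when the third event is certain; it is a product with the single
   failure probability [(1 - g) ^+ 2], charged to [D1]. *)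
have sq_le g : 0 <= g <= 1 -> a <= D2 * (1 - g) ^+ 2 ->
    1 - (1 - g) ^+ 2 <= F1 a D1 D2 D3.
  move=> /andP[? ?] ag.
  have q01 : 0 <= (1 - g) ^+ 2 <= 1 by rewrite sqr_ge0 expr_le1//; lra.
  have := up ((1 - g) ^+ 2) 0 0 q01; rewrite lexx ler01 !subr0 !mulr1.
  apply=> //; rewrite !mulr0 !addr0 (le_trans ag)// ler_wpM2r ?sqr_ge0//.
have [ag0|ag0] := lerP a (D2 * (1 - g0) ^+ 2).
  apply/orP; left; apply: le_trans (sq_le g0 _ ag0); last by rewrite g00.
  rewrite /majority -subr_ge0.
  have : 0 <= (1 - p3) * (g0 * (1 - g0)) by rewrite !mulr_ge0 ?subr_ge0.
  by lra.
(* Up to clearing denominators, [S] requires [theta a D2 D3 g] to lie in [[0, 1]]. *)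
pose S := [set g | [/\ 0 <= g <= 1, D2 * (1 - g) ^+ 2 <= a &
   a <= D3 * (1 - g ^+ 2) + D2 * (1 - g) ^+ 2]].
have Sg0 : S g0.
  split; [by rewrite g00|exact: ltW|apply: le_trans ap _].
  rewrite !expr2 lerD2r ler_wpM2r// ?ler_piMr ?(ltW D3_gt0)//; last lra.
  by rewrite subr_ge0 -[leRHS]mulr1 ler_pM.
have S1 g : S g -> g < 1.
  move=> [/andP[_ g1] _ aS]; rewrite lt_neqAle g1 andbT.
  by apply/eqP => gE; move: aS; rewrite gE; lra.
have c2 : continuous (fun g : R => D2 * (1 - g) ^+ 2).
  move=> x; apply: cvgM; first exact: cvg_cst.
  by apply: (@cvgM _ _ _ _ (fun g => 1 - g) (fun g => 1 - g));
    apply: cvgB; try exact: cvg_cst; exact: cvg_id.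
have c3 : continuous (fun g : R => D3 * (1 - g ^+ 2) + D2 * (1 - g) ^+ 2).
  move=> x; apply: cvgD; last exact: c2.
  apply: cvgM; first exact: cvg_cst.
  apply: cvgB; first exact: cvg_cst.
  by apply: (@cvgM _ _ _ _ id id); exact: cvg_id.
have cS : compact S.
  apply: (subclosed_compact _ (@segment_compact R 0 1)); last first.
    by move=> x []; rewrite /= in_itv.
  have -> : S = `[0, 1]%classic `&`
      (((fun g => D2 * (1 - g) ^+ 2) @^-1` [set x | x <= a]) `&`
       ((fun g => D3 * (1 - g ^+ 2) + D2 * (1 - g) ^+ 2) @^-1`
          [set x | a <= x])).
    by apply/seteqP; split => x /=; rewrite in_itv/= => -[? []].
  apply: closedI; first exact: interval_closed.
  apply: closedI; apply: preimage_closed; rewrite ?in_setP.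
  - by move=> ? _; exact: c2.
  - exact: closed_le.
  - by move=> ? _; exact: c3.
  - exact: closed_ge.
have dpsi t : 0 <= t -> derivable (psi a D2 D3) t 1.
  by move=> t0; have [] := is_derive_psi a D3_gt0 D32 t0.
have [c] : exists2 c, c \in S &
    forall t, t \in S -> psi a D2 D3 t <= psi a D2 D3 c.
  apply: compact_EVT_max => //; first by exists g0.
  apply: continuous_in_subspaceT => x; rewrite inE => -[/andP[x0 _] _ _].
  exact/differentiable_continuous/derivable1_diffP/dpsi.
rewrite inE => Sc maxc.
have psic : majority g0 g0 p3 <= psi a D2 D3 c.
  apply: le_trans (maxc g0 (mem_set Sg0)).
  have g01' := S1 _ Sg0.
  have g0_itv : 0 <= g0 < 1 by rewrite g00.
  rewrite psiE// /majority.
  have : 0 <= g0 * (1 - g0) by rewrite mulr_ge0 ?subr_ge0.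
  suff le_p3 : p3 <= theta a D2 D3 g0.
    by move=> g0g0; have := ler_wpM2r g0g0 le_p3; lra.
  have pos : 0 < D3 * (1 - g0 ^+ 2).
    by rewrite mulr_gt0// subr_gt0 expr_lt1.
  by rewrite -(ler_pM2r pos) thetaE//; lra.
have [/andP[c0 _] ac1 ac2] := Sc; have c1 := S1 _ Sc.
have c_itv : 0 <= c < 1 by rewrite c0.
have psi_c := psiE a D2 D3_gt0 c_itv.
have theta_c := thetaE a D2 D3_gt0 c_itv.
have pos : 0 < D3 * (1 - c ^+ 2) by rewrite mulr_gt0// subr_gt0 expr_lt1.
have [cE|c_neq0] := eqVneq c 0.
  apply/orP; left; apply: le_trans psic _.
  rewrite psi_c cE !(mulr0, mul0r) addr0.
  by apply: F1_ge0 => //; exact: ltW.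
have c_gt0 : 0 < c by rewrite lt_def c_neq0.
have [aE|a_gt] := eqVneq (D2 * (1 - c) ^+ 2) a.
  have theta1 : theta a D2 D3 c = 1.
    by apply: (mulIf (lt0r_neq0 pos)); rewrite /= theta_c; lra.
  apply/orP; left; apply: le_trans psic _.
  have := sq_le c; rewrite c0 (ltW c1) aE => /(_ isT (lexx _)).
  by rewrite psi_c theta1; lra.
(* On this boundary the third event is impossible, and [c * c] is the product with [q1 = q2 = 1 - c]
   and [q3 = 0]. *)
have [aE|a_lt] := eqVneq a (D3 * (1 - c ^+ 2) + D2 * (1 - c) ^+ 2).
  have theta0 : theta a D2 D3 c = 0.
    by apply: (mulIf (lt0r_neq0 pos)); rewrite /= theta_c; lra.
  apply/orP; left; apply: le_trans psic _.
  rewrite psi_c theta0.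
  have q01 : 0 <= 1 - c <= 1 by apply/andP; split; lra.
  have := up (1 - c) (1 - c) 0 q01 q01; rewrite lexx ler01 => /(_ isT).
  have -> : (1 - (1 - c)) * (1 - (1 - c)) * (1 - 0) =
    c * c + 0 * (2 * c * (1 - c)) by ring.
  apply; rewrite aE.
  have : 0 <= (D1 - D2) * (1 - c) by rewrite mulr_ge0// subr_ge0// ltW.
  have : 0 <= (D2 - D3) * ((1 - c) * (1 + c)).
    by apply: mulr_ge0; [lra|apply: mulr_ge0; lra].
  by lra.
apply/orP; right; apply: le_trans psic _.
have {}a_gt : D2 * (1 - c) ^+ 2 < a by rewrite lt_neqAle a_gt.
have {}a_lt : a < D3 * (1 - c ^+ 2) + D2 * (1 - c) ^+ 2.
  by rewrite lt_neqAle a_lt.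
(* No constraint binds at [c], so the maximum over [S] is a local one and [psi] has derivative zero
   there. *)
have : \forall t \near c, S t.
  near=> t; split.
  - apply/andP; split; apply: ltW; near: t;
      [exact: lt_nbhsr|exact: lt_nbhsl].
  - by apply: ltW; near: t; apply: (cvgr_lt _ (c2 c)).
  - by apply: ltW; near: t; apply: (cvgr_gt _ (c3 c)).
move=> /nbhs_ballP[e/= e0]; rewrite ball_itv => ceS.
have D0 : is_derive c 1 (psi a D2 D3) 0.
  apply: (@derive1_at_max _ _ (c - e) (c + e)).
  - by lra.
  - by move=> t /ceS[/andP[? _] _ _]; exact: dpsi.
  - by rewrite in_itv/=; apply/andP; split; lra.
  - by move=> t /ceS St; apply: maxc; rewrite inE.
have := is_derive_psi a D3_gt0 D32 c0.
move=> /(@derive_val _ _ _ _ _ _ _); rewrite (@derive_val _ _ _ _ _ _ _ D0).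
move=> /esym/eqP; rewrite mulf_eq0 => /orP[/eqP|/eqP/phi_psi_root].
  have : 0 < 2 * (2 * D2 - D3) / (D3 * (1 + c) ^+ 2).
    by rewrite divr_gt0 ?mulr_gt0 ?exprn_gt0//; lra.
  by move=> /[swap] ->; rewrite ltxx.
apply: le_trans; rewrite /phi_psi /phi /= eqxx c_gt0 c1/=.
suff -> : 0 < theta a D2 D3 c < 1 by rewrite mul1r.
rewrite -(pmulr_lgt0 _ pos) -(ltr_pM2r pos _ 1) theta_c mul1r.
by apply/andP; split; lra.
Unshelve. all: by end_near.
Qed.

End Majority.

(** * Majority events for sums of independent variables *)

Section Fill.
Variable R : realType.
Implicit Types a D p : R.

(* Water filling: the smallest probabilities are raised first. *)
Lemma majority_fill_sorted p1 p2 p3 :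
  0 <= p3 -> p3 <= p2 -> p2 <= p1 -> p1 <= 1 ->
  exists r1 r2 r3, [/\ p1 <= r1 <= 1, p2 <= r2 <= 1, p3 <= r3 <= 1,
    (r1 + r2 + r3) - (p1 + p2 + p3) <= 1 & majority p1 p2 p3 <= r1 * r2 * r3].
Proof.
move=> p30 p32 p21 p11.
have [h|h] := lerP 2 (p1 + p2 + p3).
  exists 1, 1, 1; split; try (apply/andP; split); try lra.
  by rewrite !mulr1; apply: majority_le1; apply/andP; split; lra.
have [h1|h1] := lerP 1 (p2 + p3).
  exists (p1 + p2 + p3 - 1), 1, 1; split; try (apply/andP; split); try lra.
  (* [p1 + p2 + p3 - 1 - majority p1 p2 p3] is exactly the difference of these two products. *)
  have : (1 - p2) * (1 - p1) * (1 - p3) <= p3 * p1 * p2.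
    by rewrite !ler_pM ?mulr_ge0//; lra.
  by rewrite /majority; lra.
have [s0 s1] : 0 <= p2 + p3 /\ p2 + p3 <= 1 by split; lra.
have [h2|h2] := lerP 1 (2 * p1).
  (* The whole unit goes to the two smaller probabilities, which reach a common level. *)
  exists p1, ((1 + (p2 + p3)) / 2), ((1 + (p2 + p3)) / 2).
  split; try (apply/andP; split); try lra.
  have p10 : 0 <= p1 by lra.
  have : 0 <= p2 * p3 * (2 * p1 - 1) by rewrite !mulr_ge0//; lra.
  have := mulr_ge0 p10 (sqr_ge0 (1 - (p2 + p3))).
  by rewrite /majority; lra.
(* [A ^+ 3] is compared with its tangent at [A = 2 / 3], as the slack is
   smallest at [p1 = p2 = p3 = 1 / 3]. *)
pose A := (p1 + (p2 + p3) + 1) / 3.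
exists A, A, A; rewrite /A; split; try (apply/andP; split); try lra.
have : 0 <= (1 - 2 * p1) * (p2 - p3) ^+ 2 by rewrite mulr_ge0 ?sqr_ge0//; lra.
have : majority p1 p2 p3 = p1 * (p2 + p3) + p2 * p3 * (1 - 2 * p1).
  by rewrite /majority; ring.
move=> ->.
set s := p2 + p3 in s0 s1 * => h3.
have p10 : 0 <= p1 by lra.
have k1 : 0 <= p1 * (s - 2 / 3) ^+ 2 by rewrite mulr_ge0 ?sqr_ge0.
have k2 : 0 <= (A - 2 / 3) ^+ 2 * (A - 1 / 3).
  by rewrite mulr_ge0 ?sqr_ge0// /A; lra.
have k3 : 0 <= s * (1 - s) by rewrite mulr_ge0//; lra.
have k4 : 0 <= (1 - s) * (p1 - 2 / 5) ^+ 2 by rewrite mulr_ge0 ?sqr_ge0//; lra.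
have k5 : 0 <= s * (p1 - 3 / 10) ^+ 2 by rewrite mulr_ge0 ?sqr_ge0//; lra.
by rewrite /A /s in k1 k2 k3 k4 k5 *; lra.
Qed.

Lemma majority_fill p1 p2 p3 :
  0 <= p1 <= 1 -> 0 <= p2 <= 1 -> 0 <= p3 <= 1 ->
  exists r1 r2 r3, [/\ p1 <= r1 <= 1, p2 <= r2 <= 1, p3 <= r3 <= 1,
    (r1 + r2 + r3) - (p1 + p2 + p3) <= 1 & majority p1 p2 p3 <= r1 * r2 * r3].
Proof.
move=> /andP[p10 p11] /andP[p20 p21] /andP[p30 p31].
have [h12|/ltW h12] := leP p1 p2; have [h23|/ltW h23] := leP p2 p3;
    have [h13|/ltW h13] := leP p1 p3.
- have [r3 [r2 [r1 [k1 k2 k3 k4 k5]]]] := majority_fill_sorted p10 h12 h23 p31.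
  by exists r1, r2, r3; split => //; rewrite /majority in k5 *; lra.
- have [r3 [r2 [r1 [k1 k2 k3 k4 k5]]]] := majority_fill_sorted p10 h12 h23 p31.
  by exists r1, r2, r3; split => //; rewrite /majority in k5 *; lra.
- have [r2 [r3 [r1 [k1 k2 k3 k4 k5]]]] := majority_fill_sorted p10 h13 h23 p21.
  by exists r1, r2, r3; split => //; rewrite /majority in k5 *; lra.
- have [r2 [r1 [r3 [k1 k2 k3 k4 k5]]]] := majority_fill_sorted p30 h13 h12 p21.
  by exists r1, r2, r3; split => //; rewrite /majority in k5 *; lra.
- have [r3 [r1 [r2 [k1 k2 k3 k4 k5]]]] := majority_fill_sorted p20 h12 h13 p31.
  by exists r1, r2, r3; split => //; rewrite /majority in k5 *; lra.
- have [r1 [r3 [r2 [k1 k2 k3 k4 k5]]]] := majority_fill_sorted p20 h23 h13 p11.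
  by exists r1, r2, r3; split => //; rewrite /majority in k5 *; lra.
- have [r1 [r2 [r3 [k1 k2 k3 k4 k5]]]] := majority_fill_sorted p30 h23 h12 p11.
  by exists r1, r2, r3; split => //; rewrite /majority in k5 *; lra.
- have [r1 [r2 [r3 [k1 k2 k3 k4 k5]]]] := majority_fill_sorted p30 h23 h12 p11.
  by exists r1, r2, r3; split => //; rewrite /majority in k5 *; lra.
Qed.

(** Raising each [p] to [r] lowers [e] by at most the largest of [d1], [d2], [d3], since the total
    raise is at most 1. The constraint with slack thus leaves at least [a], and [prod_le_F1] applies
    to [r1 * r2 * r3]. *)
Lemma majority_le_F1 a D1 D2 D3 p1 p2 p3 (d1 d2 d3 e : R) :
  0 <= a -> D2 <= D1 -> D3 <= D2 -> 0 < D3 ->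
  0 <= p1 <= 1 -> 0 <= p2 <= 1 -> 0 <= p3 <= 1 ->
  0 <= d1 <= D1 -> 0 <= d2 <= D2 -> 0 <= d3 <= D3 ->
  e = (1 - p1) * d1 + (1 - p2) * d2 + (1 - p3) * d3 ->
  a + d1 <= e -> a + d2 <= e -> a + d3 <= e ->
  majority p1 p2 p3 <= F1 a D1 D2 D3.
Proof.
move=> a0 D21 D32 D3_gt0 h1 h2 h3 /andP[d10 dD1] /andP[d20 dD2] /andP[d30 dD3].
move=> eE ae1 ae2 ae3.
have [r1 [r2 [r3 [/andP[pr1 r11] /andP[pr2 r21] /andP[pr3 r31] sr]]]] :=
  majority_fill h1 h2 h3.
move=> /le_trans; apply.
have -> : r1 * r2 * r3 = (1 - (1 - r1)) * (1 - (1 - r2)) * (1 - (1 - r3)).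
  by rewrite !subKr.
have /andP[? ?] := h1; have /andP[? ?] := h2; have /andP[? ?] := h3.
apply: prod_le_F1 => //; try by apply/andP; split; lra.
apply: (@le_trans _ _ (d1 * (1 - r1) + d2 * (1 - r2) + d3 * (1 - r3)));
  last by rewrite !lerD// ler_wpM2r ?subr_ge0.
suff [m m0 [dm1 dm2 dm3 am]] : exists2 m, 0 <= m &
    [/\ d1 <= m, d2 <= m, d3 <= m & a + m <= e].
  have h : 0 <= m * (1 - (r1 + r2 + r3 - (p1 + p2 + p3))).
    by rewrite mulr_ge0 ?subr_ge0.
  have : 0 <= (m - d1) * (r1 - p1) by rewrite mulr_ge0 ?subr_ge0.
  have : 0 <= (m - d2) * (r2 - p2) by rewrite mulr_ge0 ?subr_ge0.
  have : 0 <= (m - d3) * (r3 - p3) by rewrite mulr_ge0 ?subr_ge0.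
  by rewrite eE in am; clear -am h; lra.
have [h12|/ltW h12] := leP d1 d2; last first.
  have [h13|/ltW h13] := leP d1 d3; [exists d3|exists d1] => //.
    by split => //; apply: le_trans h13.
have [h23|/ltW h23] := leP d2 d3; [exists d3|exists d2] => //.
by split => //; apply: le_trans h23.
Qed.

(** * Bounds for functions on the cube *)

Definition flip p (s : bool) := if s then 1 - p else p.

Lemma flip_itv p s : 0 <= p <= 1 -> 0 <= flip p s <= 1.
Proof. by move=> /andP[p0 p1]; case: s => /=; apply/andP; split; lra. Qed.

Lemma cube_mean_flip p1 p2 p3 s1 s2 s3 (g : bool -> bool -> bool -> R) :
  cube_mean (flip p1 s1) (flip p2 s2) (flip p3 s3)
    (fun b1 b2 b3 => g (s1 (+) b1) (s2 (+) b2) (s3 (+) b3)) =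
  cube_mean p1 p2 p3 g.
Proof.
by rewrite /cube_mean /mix; case: s1; case: s2; case: s3 => /=; ring.
Qed.

Lemma cube_reduction a D1 D2 D3 p1 p2 p3 (F : bool -> bool -> bool -> R) :
  0 <= a -> D2 <= D1 -> D3 <= D2 -> 0 < D3 ->
  0 <= p1 <= 1 -> 0 <= p2 <= 1 -> 0 <= p3 <= 1 ->
  cube_osc D1 D2 D3 F -> cube_mean p1 p2 p3 F <= 0 ->
  cube_prob p1 p2 p3 a F <= F1 a D1 D2 D3 \/
  exists s1 s2 s3, let G b1 b2 b3 := F (s1 (+) b1) (s2 (+) b2) (s3 (+) b3) in
  [/\ cube_prob p1 p2 p3 a F =
      majority (flip p1 s1) (flip p2 s2) (flip p3 s3),
      cube_mean (flip p1 s1) (flip p2 s2) (flip p3 s3) G <= 0,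
      [/\ a <= G true true true, a <= G true true false,
          a <= G true false true & a <= G false true true] &
      [/\ G true false false < a, G false true false < a,
          G false false true < a & G false false false < a - D1]].
Proof.
move=> a0 D21 D32 D3_gt0 h1 h2 h3 oscF F0.
have D1_gt0 : 0 < D1 by lra.
have [[s1 [s2 [s3 Fs]]]|noF] :=
    pselect (exists s1 s2 s3, F s1 s2 s3 < a - D1); last first.
  left; pose q := 1 - cube_prob p1 p2 p3 a F.
  have : 0 <= q <= 1.
    have /andP[? ?] := cube_freq_itv (fun b1 b2 b3 => a <= F b1 b2 b3) h1 h2 h3.
    by rewrite /q /cube_prob; apply/andP; split; lra.
  have -> : cube_prob p1 p2 p3 a F = (1 - q) * (1 - 0) * (1 - 0).
    by rewrite /q !subr0 !mulr1 subKr.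
  move=> q01; apply: prod_le_F1; rewrite ?lexx ?ler01//.
  (* In mean this yields [a - D1 * q <= 0], so the whole failure probability [q] may be charged to
     the first coordinate. *)
  have aF b1 b2 b3 : a - D1 + D1 * (a <= F b1 b2 b3)%R%:R <= F b1 b2 b3.
    case: (lerP a (F b1 b2 b3)) => [|_]; first by rewrite mulr1; lra.
    rewrite mulr0 addr0 leNgt; apply/negP => h.
    by apply: noF; exists b1, b2, b3.
  have := le_cube_mean h1 h2 h3 aF.
  move=> /le_trans /(_ F0).
  by rewrite /q /cube_prob /cube_freq /cube_mean /mix; clear; lra.
pose G b1 b2 b3 := F (s1 (+) b1) (s2 (+) b2) (s3 (+) b3).
have oscG : cube_osc D1 D2 D3 G.
  by case: oscF => oscF1 oscF2 oscF3; split => *; rewrite /G.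
have PG : cube_prob (flip p1 s1) (flip p2 s2) (flip p3 s3) a G =
    cube_prob p1 p2 p3 a F.
  exact: (cube_mean_flip _ _ _ _ _ _ (fun b1 b2 b3 => (a <= F b1 b2 b3)%R%:R)).
have G0 : cube_mean (flip p1 s1) (flip p2 s2) (flip p3 s3) G <= 0.
  by rewrite cube_mean_flip.
have G000 : G false false false < a - D1 by rewrite /G !addbF.
have f1 := flip_itv s1 h1; have f2 := flip_itv s2 h2.
have f3 := flip_itv s3 h3.
have [|aG] := cube_corner a0 D21 D32 D3_gt0 f1 f2 f3 oscG G0 G000.
  by rewrite PG; left.
right; exists s1, s2, s3; rewrite -/G -PG.
have [osc1G osc2G osc3G] := oscG.
have G100 : G true false false < a by have := osc1G true false false false; lra.
have G010 : G false true false < a by have := osc2G false true false false; lra.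
have G001 : G false false true < a by have := osc3G false false true false; lra.
split => //.
rewrite /cube_prob /cube_freq /cube_mean.
rewrite (lt_geF G100) (lt_geF G010) (lt_geF G001).
rewrite (lt_geF (lt_trans G000 _)) ?gtrDl ?oppr_lt0//.
by case: aG => -> -> -> ->; rewrite /mix /majority /=; clear; ring.
Qed.

Lemma cube_mcdiarmid a D1 D2 D3 p1 p2 p3 (F : bool -> bool -> bool -> R) :
  0 <= a -> D2 <= D1 -> D3 <= D2 -> 0 < D3 ->
  0 <= p1 <= 1 -> 0 <= p2 <= 1 -> 0 <= p3 <= 1 ->
  cube_osc D1 D2 D3 F -> cube_mean p1 p2 p3 F <= 0 ->
  cube_prob p1 p2 p3 a F <= Num.max (F1 a D1 D2 D3) (F2 a D2 D3).
Proof.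
move=> a0 D21 D32 D3_gt0 h1 h2 h3 oscF F0.
have [h|[s1 [s2 [s3 [-> G0 [aG1 aG2 aG3 aG4] _]]]]] :=
  cube_reduction a0 D21 D32 D3_gt0 h1 h2 h3 oscF F0.
  by rewrite le_max h.
have f1 := flip_itv s1 h1; have f2 := flip_itv s2 h2.
have f3 := flip_itv s3 h3.
apply: majority_le => //.
have oscG : cube_osc D1 D2 D3
    (fun b1 b2 b3 => F (s1 (+) b1) (s2 (+) b2) (s3 (+) b3)).
  by case: oscF => oscF1 oscF2 oscF3; split => *.
(* Flip the second coordinate if the first two fail, and the third if it fails and the first two do
   not both succeed; the mean charge is the one in [majority_le]. *)
have := @cube_cover _ a D1 D2 D3 _ _ _ _
  [:: (true, true, true); (true, true, false); (true, false, true);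
      (false, true, true)]
  (fun _ _ _ => false) (fun b1 b2 _ => ~~ b1 && ~~ b2)
  (fun b1 b2 b3 => ~~ b3 && ~~ (b1 && b2)) D21 D32 D3_gt0 f1 f2 f3 oscG G0.
rewrite /= aG1 aG2 aG3 aG4 => /(_ isT ltac:(by do 3!case)).
move: (flip _ _) (flip _ _) (flip _ _) => q1 q2 q3.
by rewrite /cube_freq /cube_mean /mix /=; clear; lra.
Qed.

Lemma cube_hoeffding a D1 D2 D3 p1 p2 p3 (x y z : bool -> R) :
  0 <= a -> D2 <= D1 -> D3 <= D2 -> 0 < D3 ->
  0 <= p1 <= 1 -> 0 <= p2 <= 1 -> 0 <= p3 <= 1 ->
  let F b1 b2 b3 := x b1 + y b2 + z b3 in
  cube_osc D1 D2 D3 F -> cube_mean p1 p2 p3 F <= 0 ->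
  cube_prob p1 p2 p3 a F <= F1 a D1 D2 D3.
Proof.
move=> a0 D21 D32 D3_gt0 h1 h2 h3 F oscF F0.
have [//|[s1 [s2 [s3 [-> G0 [aG1 aG2 aG3 aG4] [G1 G2 G3 _]]]]]] :=
  cube_reduction a0 D21 D32 D3_gt0 h1 h2 h3 oscF F0.
have f1 := flip_itv s1 h1; have f2 := flip_itv s2 h2.
have f3 := flip_itv s3 h3.
have [oscF1 oscF2 oscF3] := oscF.
have := oscF1 (s1 (+) true) (s1 (+) false) false false.
have := oscF2 false (s2 (+) true) (s2 (+) false) false.
have := oscF3 false false (s3 (+) true) (s3 (+) false).
move: f1 f2 f3 G0 aG1 aG2 aG3 aG4 G1 G2 G3; rewrite /F /cube_mean.
move: (flip _ _) (flip _ _) (flip _ _) => q3 q2 q1.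
move: (x (s1 (+) true)) (x (s1 (+) false)) (y (s2 (+) true)) (y (s2 (+) false))
  (z (s3 (+) true)) (z (s3 (+) false)) => x1 x0 y1 y0 z1 z0.
rewrite /mix => f1 f2 f3 G0 aG1 aG2 aG3 aG4 G1 G2 G3 osc3 osc2 osc1.
(* For a sum, [e] is the value at [111] minus the mean. Each vertex with a single [false] lies one
   oscillation below [111], whence the slack. *)
apply: (@majority_le_F1 a D1 D2 D3 q1 q2 q3 (x1 - x0) (y1 - y0) (z1 - z0)
  _ a0 D21 D32 D3_gt0 f1 f2 f3 _ _ _ erefl).
- by clear -aG3 G3 osc1; apply/andP; split; lra.
- by clear -aG2 G1 osc2; apply/andP; split; lra.
- by clear -aG4 G2 osc3; apply/andP; split; lra.
- by clear -aG4 G0; lra.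
- by clear -aG3 G0; lra.
- by clear -aG2 G0; lra.
Qed.

End Fill.

(** * Reduction to two atoms *)

Definition bounded_measurable (R : realType) d (T : measurableType d)
    (f : T -> R) :=
  measurable_fun setT f /\ exists M, forall x, `|f x| <= M.

Section BoundedMeasurable.
Context (R : realType) d (T : measurableType d).
Implicit Types (f g : T -> R) (mu : probability T R).

Lemma bmD f g : bounded_measurable f -> bounded_measurable g ->
  bounded_measurable (fun x => f x + g x).
Proof.
move=> [mf [M fM]] [mg [N gN]]; split; first exact: measurable_funD.
by exists (M + N) => x; rewrite (le_trans (ler_normD _ _))// lerD.
Qed.

Lemma bmZ (c : R) f : bounded_measurable f ->
  bounded_measurable (fun x => c * f x).
Proof.
move=> [mf [M fM]]; split; first exact: measurable_funM.
by exists (`|c| * M) => x; rewrite normrM ler_wpM2l.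
Qed.

Lemma bm_cst (c : R) : bounded_measurable (fun _ : T => c).
Proof. by split; [exact: measurable_cst|exists `|c|]. Qed.

Lemma bm_integrable mu f : bounded_measurable f ->
  mu.-integrable setT (EFin \o f).
Proof.
move=> [mf [M fM]]; apply: measurable_bounded_integrable => //.
  by apply: (@le_lt_trans _ _ 1%E); [exact: probability_le1|exact: ltry].
exists M; split; first exact: num_real.
by move=> N MN x _; apply: le_trans (fM x) (ltW MN).
Qed.

Lemma EFin_Rintegral mu f : bounded_measurable f ->
  (\int[mu]_x f x)%:E = (\int[mu]_x (f x)%:E)%E.
Proof.
move=> bf; rewrite /Rintegral fineK// integrable_fin_num//.
exact: bm_integrable.
Qed.

Lemma Rintegral_cst1 mu (c : R) : \int[mu]_x c = c.
Proof.
rewrite /Rintegral integral_cst//= (_ : mu _ = 1%E) ?mule1//.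
exact: probability_setT.
Qed.

Lemma Rintegral_le_bound mu f M : bounded_measurable f ->
  (forall x, `|f x| <= M) -> `|\int[mu]_x f x| <= M.
Proof.
move=> bf fM; rewrite -lee_fin EFin_normr_Rintegral//;
  last exact: bm_integrable.
apply: le_trans (le_abse_integral _ _ _) _ => //.
  by apply/measurable_EFinP; case: bf.
apply: (@le_trans _ _ (\int[mu]_x M%:E)%E).
  apply: ge0_le_integral => //=.
  - by apply/measurable_EFinP; apply: measurableT_comp => //; case: bf.
  - by move=> x _; rewrite lee_fin.
by rewrite integral_cst//= (probability_setT mu) mule1.
Qed.

Lemma ae_eq0_mean0 mu f : bounded_measurable f -> \int[mu]_x f x = 0 ->
  {ae mu, forall x, f x <= 0} -> {ae mu, forall x, f x = 0}.
Proof.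
move=> bf f0 f_le0.
have mf : measurable_fun setT (EFin \o f) by apply/measurable_EFinP; case: bf.
have : (\int[mu]_x `|(EFin \o f) x| = 0)%E.
  rewrite (ae_eq_integral (fun x => (-1%:E) * (EFin \o f) x)%E)//.
  - rewrite integralZl//; last exact: bm_integrable.
    by rewrite -EFin_Rintegral// f0 mule0.
  - exact: measurableT_comp.
  - exact: measurable_funeM.
  - apply: filterS f_le0 => x fx _ /=.
    by rewrite mulN1e ler0_norm.
move=> /(ae_eq_integral_abs _ measurableT mf); apply: filterS => x /(_ I).
by case.
Qed.

(** After centring, two values of [(u, w)] must span a segment meeting the closed positive quadrant.
    Otherwise a line through the origin separates the values from the quadrant, mean zero puts
    almost all of them on one ray of it, and then [w] vanishes almost everywhere, against [K]. *)
Lemma two_point mu f g : bounded_measurable f -> bounded_measurable g ->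
  exists x y p, [/\ 0 <= p <= 1, \int[mu]_x f x <= mix p (f x) (f y) &
    mix p (g x) (g y) <= \int[mu]_x g x].
Proof.
move=> bf bg.
pose u x := f x + (- \int[mu]_x f x); pose w x := -1 * g x + \int[mu]_x g x.
have bu : bounded_measurable u by apply: bmD => //; exact: bm_cst.
have bw : bounded_measurable w by apply: bmD; [exact: bmZ|exact: bm_cst].
have u0 : \int[mu]_x u x = 0.
  rewrite /u RintegralD//; try exact: bm_integrable.
    by rewrite Rintegral_cst1 subrr.
  exact/bm_integrable/bm_cst.
have w0 : \int[mu]_x w x = 0.
  rewrite /w RintegralD//; last 2 first.
  - exact/bm_integrable/bmZ.
  - exact/bm_integrable/bm_cst.
  rewrite RintegralZl//; last exact: bm_integrable.
  by rewrite Rintegral_cst1 mulN1r addNr.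
suff [x [y [p [p01 ux wx]]]] : exists x y p,
    [/\ 0 <= p <= 1, 0 <= mix p (u x) (u y) & 0 <= mix p (w x) (w y)].
  exists x, y, p; split => //; move: ux wx; rewrite /mix /u /w; clear; lra.
apply: contrapT => no.
have H1 x : 0 <= u x -> 0 <= w x -> False.
  move=> ux wx; apply: no; exists x, x, 0; rewrite lexx ler01.
  by split; rewrite // /mix mul0r add0r subr0 mul1r.
have H2 x y : 0 < u x -> u y < 0 -> u x * w y < u y * w x.
  move=> ux uy; rewrite ltNge; apply/negP => h; apply: no.
  (* The weight is chosen so that [u] vanishes at the mixture. *)
  exists y, x, (u x / (u x - u y)).
  have d0 : 0 < u x - u y by lra.
  have ud : (1 - u x / (u x - u y)) = - u y / (u x - u y).
    by field; rewrite gt_eqF.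
  rewrite /mix ud; split.
  - apply/andP; split; first by rewrite divr_ge0// ltW.
    by rewrite ler_pdivrMr// mul1r; lra.
  - by rewrite le_eqVlt; apply/orP; left; apply/eqP; field; rewrite gt_eqF.
  - rewrite (_ : _ + _ = (u x * w y - u y * w x) / (u x - u y)).
      by apply: divr_ge0; [rewrite subr_ge0|exact: ltW].
    by field; rewrite gt_eqF.
have properae : ProperFilter (almost_everywhere mu).
  apply: ae_properfilter_algebraOfSetsType.
  have : (0 < 1 :> \bar R)%E := lte01.
  by rewrite -(probability_setT mu).
have ae_ex (P : T -> Prop) : {ae mu, forall x, P x} -> exists x, P x.
  exact: filter_ex.
have K : ~ {ae mu, forall x, w x = 0}.
  move=> wx0.
  have u_lt0 : {ae mu, forall x, u x < 0}.
    apply: filterS wx0 => x wx0; rewrite ltNge; apply/negP => /H1; apply.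
    by rewrite wx0.
  have u_eq0 : {ae mu, forall x, u x = 0}.
    by apply: ae_eq0_mean0 => //; apply: filterS u_lt0 => x /ltW.
  have [x [ux]] := ae_ex _ (filterI u_lt0 u_eq0).
  by move=> ux0; move: ux; rewrite ux0 ltxx.
have wpos : exists l, 0 < w l.
  apply: contrapT => nol; apply: K; apply: ae_eq0_mean0 => //.
  by apply: aeW => x; rewrite leNgt; apply/negP => wx; apply: nol; exists x.
have upos : exists r, 0 < u r.
  apply: contrapT => nor.
  have u_eq0 : {ae mu, forall x, u x = 0}.
    apply: ae_eq0_mean0 => //.
    by apply: aeW => x; rewrite leNgt; apply/negP => ux; apply: nor; exists x.
  apply: K; apply: ae_eq0_mean0 => //; apply: filterS u_eq0 => x ux0.
  by rewrite leNgt; apply/negP => /ltW; apply: H1; rewrite ux0.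
have [l wl] := wpos; have [r ur] := upos.
have neg_u x : 0 <= w x -> u x < 0.
  by move=> wx; rewrite ltNge; apply/negP => /H1; apply.
have neg_w x : 0 <= u x -> w x < 0.
  by move=> ux; rewrite ltNge; apply/negP; exact: H1.
pose E := [set u x / - w x | x in [set x | 0 <= u x]].
have E_lt x y : 0 <= u x -> 0 < w y -> u x / - w x < - u y / w y.
  move=> ux wy; have wx := neg_w _ ux; have uy := neg_u _ (ltW wy).
  rewrite ltr_pdivrMr ?oppr_gt0// mulrAC ltr_pdivlMr//.
  have [ux0|ux_neq0] := eqVneq (u x) 0.
    by rewrite ux0 mul0r mulrNN nmulr_rgt0.
  have := H2 x y; rewrite lt_def ux_neq0 ux => /(_ isT uy); lra.
have Esup : has_sup E.
  split; first by exists (u r / - w r), r => //; exact: ltW.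
  by exists (- u l / w l) => _ [x /= ux <-]; apply/ltW/E_lt.
(* The line [u + lam * w = 0] separates the points [(u x, w x)] from the
   positive quadrant, hence contains almost all of them. *)
pose lam := sup E.
have lam_ge x : 0 <= u x -> u x <= lam * - w x.
  move=> ux; rewrite -ler_pdivrMr ?oppr_gt0 ?neg_w//.
  by apply: sup_upper_bound => //; exists x.
have lam_le y : 0 < w y -> lam * w y <= - u y.
  move=> wy; rewrite -ler_pdivlMr//; apply: ge_sup; first by case: Esup.
  by move=> _ [x /= ux <-]; apply/ltW/E_lt.
have lam0 : 0 <= lam.
  apply: (@le_trans _ _ (u r / - w r)).
    by rewrite divr_ge0 ?(ltW ur)// oppr_ge0 ltW// neg_w// ltW.
  by apply: sup_upper_bound => //; exists r => //; exact: ltW.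
have line : {ae mu, forall x, u x + lam * w x = 0}.
  apply: ae_eq0_mean0.
  - by apply: bmD => //; exact: bmZ.
  - rewrite RintegralD//; [|exact: bm_integrable|exact/bm_integrable/bmZ].
    by rewrite RintegralZl//; [rewrite u0 w0 mulr0 addr0|exact: bm_integrable].
  - apply: aeW => x; have [ux|ux] := lerP 0 (u x).
      by have := lam_ge _ ux; lra.
    have [wx|wx] := ltrP 0 (w x); first by have := lam_le _ wx; lra.
    have : 0 <= lam * - w x by rewrite mulr_ge0// oppr_ge0.
    by lra.
(* Two values on opposite rays of the line would contradict the strict inequality [E_lt], so [w] has
   a constant sign almost everywhere. *)
have [[x [xl wx]]|nox] := pselect (exists x, u x + lam * w x = 0 /\ w x < 0).
  apply: K; apply: ae_eq0_mean0 => //; apply: filterS line => y yl.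
  rewrite leNgt; apply/negP => wy.
  have ux : 0 <= u x.
    have : 0 <= lam * - w x by rewrite mulr_ge0// oppr_ge0 ltW.
    by lra.
  have := E_lt _ _ ux wy.
  have -> : u x = lam * - w x by lra.
  have -> : - u y = lam * w y by lra.
  by rewrite mulfK ?oppr_eq0 ?(lt_eqF wx)// mulfK ?(gt_eqF wy)// ltxx.
apply: K.
have bNw : bounded_measurable (fun x => -1 * w x) by exact: bmZ.
suff : {ae mu, forall x, -1 * w x = 0}.
  by apply: filterS => x; lra.
apply: ae_eq0_mean0 => //.
  by rewrite RintegralZl//; [rewrite w0 mulr0|exact: bm_integrable].
apply: filterS line => x xl; rewrite mulN1r oppr_le0 leNgt; apply/negP => wx.
by apply: nox; exists x.
Qed.

End BoundedMeasurable.

(** * Reducing a product measure one factor at a time *)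

Section ProductTwoPoint.
Context (R : realType) d1 d2 (U : measurableType d1) (V : measurableType d2).
Implicit Types (f g : U * V -> R).

Lemma bm_section f v : bounded_measurable f ->
  bounded_measurable (fun u => f (u, v)).
Proof.
move=> [mf [M fM]]; split; last by exists M => u.
by apply: measurableT_comp => //; exact: pair2_measurable.
Qed.

Lemma bm_mix p (f g : U -> R) : bounded_measurable f -> bounded_measurable g ->
  bounded_measurable (fun u => mix p (f u) (g u)).
Proof. by move=> bf bg; apply: bmD; exact: bmZ. Qed.

Lemma Rintegral_mix (mu : probability U R) p (f g : U -> R) :
  bounded_measurable f -> bounded_measurable g ->
  \int[mu]_u mix p (f u) (g u) = mix p (\int[mu]_u f u) (\int[mu]_u g u).
Proof.
move=> bf bg; rewrite RintegralD//; last 2 first.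
- exact/bm_integrable/bmZ.
- exact/bm_integrable/bmZ.
by rewrite !RintegralZl//; exact: bm_integrable.
Qed.

Variables (mu : probability U R) (nu : probability V R).

Lemma bm_Rintegral f : bounded_measurable f ->
  bounded_measurable (fun v => \int[mu]_u f (u, v)).
Proof.
move=> bf; have [mf [M fM]] := bf; split.
  apply/measurable_EFinP.
  rewrite (_ : _ \o _ = fubini_G mu (EFin \o f)).
    by apply: measurable_fubini_G; exact: (bm_integrable (mu \x nu)%E bf).
  apply/funext => v /=; rewrite EFin_Rintegral//; exact: bm_section.
by exists M => v; apply: Rintegral_le_bound => //; exact: bm_section.
Qed.

Lemma Rintegral_prod f : bounded_measurable f ->
  \int[nu]_v (\int[mu]_u f (u, v)) = \int[(mu \x nu)%E]_z f z.
Proof.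
move=> bf; apply: EFin_inj.
rewrite EFin_Rintegral; last exact: bm_Rintegral.
rewrite (EFin_Rintegral (mu \x nu)%E bf).
rewrite -integral21_prod_meas1; last exact: (bm_integrable (mu \x nu)%E bf).
by apply: eq_integral => v _; rewrite EFin_Rintegral//; exact: bm_section.
Qed.

(** [two_point] is applied to the partial integrals over the first factor, viewed as functions on
    the second. *)
Lemma prod_two_point f g : bounded_measurable f -> bounded_measurable g ->
  exists v1 v0 p, [/\ 0 <= p <= 1,
    \int[(mu \x nu)%E]_z f z <= \int[mu]_u mix p (f (u, v1)) (f (u, v0)) &
    \int[mu]_u mix p (g (u, v1)) (g (u, v0)) <= \int[(mu \x nu)%E]_z g z].
Proof.
move=> bf bg.
have [v1 [v0 [p [p01 fle gle]]]] :=
  two_point nu (bm_Rintegral bf) (bm_Rintegral bg).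
exists v1, v0, p; split => //.
- by rewrite Rintegral_mix -?Rintegral_prod//; exact: bm_section.
- by rewrite Rintegral_mix -?Rintegral_prod//; exact: bm_section.
Qed.

End ProductTwoPoint.

Section CubeReduction.
Context (R : realType) d1 d2 d3 (T1 : measurableType d1)
  (T2 : measurableType d2) (T3 : measurableType d3).
Variables (mu1 : probability T1 R) (mu2 : probability T2 R)
  (mu3 : probability T3 R).

Lemma prob3_two_points (f g : T1 * T2 * T3 -> R) :
  bounded_measurable f -> bounded_measurable g ->
  exists (x : bool -> T1) (y : bool -> T2) (z : bool -> T3) (p1 p2 p3 : R),
  [/\ [/\ 0 <= p1 <= 1, 0 <= p2 <= 1 & 0 <= p3 <= 1],
      \int[prob3 mu1 mu2 mu3]_t f t <=
        cube_mean p1 p2 p3 (fun b1 b2 b3 => f (x b1, y b2, z b3)) &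
      cube_mean p1 p2 p3 (fun b1 b2 b3 => g (x b1, y b2, z b3)) <=
        \int[prob3 mu1 mu2 mu3]_t g t].
Proof.
move=> bf bg.
have [z1 [z0 [p3 [p3_01 f3 g3]]]] := prod_two_point (mu1 \x mu2)%E mu3 bf bg.
pose f' u := mix p3 (f (u, z1)) (f (u, z0)).
pose g' u := mix p3 (g (u, z1)) (g (u, z0)).
have bf' : bounded_measurable f' by apply: bm_mix; exact: bm_section.
have bg' : bounded_measurable g' by apply: bm_mix; exact: bm_section.
have [y1 [y0 [p2 [p2_01 f2 g2]]]] := prod_two_point mu1 mu2 bf' bg'.
pose f'' u := mix p2 (f' (u, y1)) (f' (u, y0)).
pose g'' u := mix p2 (g' (u, y1)) (g' (u, y0)).
have bf'' : bounded_measurable f'' by apply: bm_mix; exact: bm_section.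
have bg'' : bounded_measurable g'' by apply: bm_mix; exact: bm_section.
have [x1 [x0 [p1 [p1_01 f1 g1]]]] := two_point mu1 bf'' bg''.
exists (fun b => if b then x1 else x0), (fun b => if b then y1 else y0),
  (fun b => if b then z1 else z0), p1, p2, p3; split => //.
  exact: le_trans f3 (le_trans f2 f1).
exact: le_trans (le_trans g1 g2) g3.
Qed.

End CubeReduction.

(** The measure is the image of a Bernoulli law. Change of variables is applied to nonnegative
    integrands, so [f] is first shifted by a bound [M]. *)
Lemma two_point_measure (R : realType) d (T : measurableType d) (x y : T)
    (p : R) : 0 <= p <= 1 ->
  exists nu : probability T R, forall f, bounded_measurable f ->
    \int[nu]_t f t = mix p (f x) (f y).
Proof.
move=> p01; pose phi b := if b then x else y.
have mphi : measurable_fun setT phi by [].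
pose X : {mfun bool >-> T} := mfun_Sub (mem_set mphi).
exists (distribution (bernoulli_prob p) X) => f bf.
have [mf [M fM]] := bf.
have ge0_case (g : T -> R) : bounded_measurable g -> (forall t, 0 <= g t) ->
    \int[distribution (bernoulli_prob p) X]_t g t = mix p (g x) (g y).
  move=> bg g0; rewrite /Rintegral ge0_integral_pushforward//=; last 2 first.
  - by apply/measurable_EFinP; case: bg.
  - by move=> t _; rewrite lee_fin.
  rewrite integral_bernoulli_prob//= => b; by rewrite lee_fin.
have bM : bounded_measurable (fun t => f t + M).
  by apply: bmD => //; exact: bm_cst.
have := ge0_case _ bM.
have fM0 t : 0 <= f t + M.
  by have := fM t; rewrite ler_norml => /andP[]; lra.
move=> /(_ fM0); rewrite RintegralD//; last 2 first.
- exact: bm_integrable.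
- exact/bm_integrable/bm_cst.
by rewrite Rintegral_cst1 /mix; lra.
Qed.

(** * From arbitrary scenarios to the cube *)

Section Upper.
Context (R : realType) d1 d2 d3 (T1 : measurableType d1)
  (T2 : measurableType d2) (T3 : measurableType d3).
Implicit Types (a D : R) (f : T1 * T2 * T3 -> R).

Definition coord_osc D1 D2 D3 f :=
  [/\ forall x x' y z, f (x, y, z) - f (x', y, z) <= D1,
      forall x y y' z, f (x, y, z) - f (x, y', z) <= D2 &
      forall x y z z', f (x, y, z) - f (x, y, z') <= D3].

Lemma coord_osc_bounded D1 D2 D3 f : measurable_fun setT f ->
  coord_osc D1 D2 D3 f -> bounded_measurable f.
Proof.
move=> mf [f1 f2 f3]; split => //.
have [[[[x0 y0] z0] _]|no] := pselect (exists t : T1 * T2 * T3, True);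
    last by exists 0 => t; exfalso; apply: no; exists t.
exists (`|f (x0, y0, z0)| + (D1 + D2 + D3)) => -[[x y] z].
rewrite -[f (x, y, z)](subrKC (f (x0, y0, z0))) (le_trans (ler_normD _ _))//.
rewrite lerD2l ler_norml.
have := f1 x x0 y z; have := f1 x0 x y z.
have := f2 x0 y y0 z; have := f2 x0 y0 y z.
have := f3 x0 y0 z z0; have := f3 x0 y0 z0 z.
by move=> *; apply/andP; split; lra.
Qed.

Lemma bm_superlevel a f : measurable_fun setT f ->
  bounded_measurable (\1_[set t | a <= f t] : T1 * T2 * T3 -> R).
Proof.
move=> mf; split; last first.
  by exists 1 => t; rewrite indicE ger0_norm ?lern1 ?leq_b1.
apply: measurable_indic; rewrite -[X in measurable X]setTI.
by apply: measurable_fun_le => //; exact: measurable_cst.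
Qed.

(** The indicator of the event and [f] itself are the pair given to [prob3_two_points]: the
    probability does not decrease and the mean does not increase. *)
Lemma prob3_reduction a D1 D2 D3 mu1 mu2 mu3 f :
  measurable_fun setT f -> coord_osc D1 D2 D3 f ->
  ('E_(prob3 mu1 mu2 mu3)[f] <= 0)%E ->
  exists (x : bool -> T1) (y : bool -> T2) (z : bool -> T3) (p1 p2 p3 : R),
  let F b1 b2 b3 := f (x b1, y b2, z b3) in
  [/\ [/\ 0 <= p1 <= 1, 0 <= p2 <= 1 & 0 <= p3 <= 1], cube_osc D1 D2 D3 F,
      cube_mean p1 p2 p3 F <= 0 &
      (prob3 mu1 mu2 mu3 [set t | (a <= f t)%R]
        <= (cube_prob p1 p2 p3 a F)%:E)%E].
Proof.
move=> mf oscf Ef; have bf := coord_osc_bounded mf oscf.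
have [x [y [z [p1 [p2 [p3 [p01 Ple Ele]]]]]]] :=
  prob3_two_points mu1 mu2 mu3 (bm_superlevel a mf) bf.
exists x, y, z, p1, p2, p3 => /=; split => //.
- by case: oscf => f1 f2 f3; split.
- apply: le_trans Ele _; rewrite -lee_fin EFin_Rintegral//.
  by move: Ef; rewrite unlock.
- have mA : measurable [set t | a <= f t].
    by rewrite -[X in measurable X]setTI; exact: measurable_fun_le.
  rewrite -[X in (X <= _)%E](_ : (\int[prob3 mu1 mu2 mu3]_t
      \1_[set t | (a <= f t)%R] t)%:E = _); last first.
    rewrite EFin_Rintegral; last exact: bm_superlevel.
    by rewrite integral_indic// setIT.
  rewrite lee_fin (le_trans Ple)// /cube_prob /cube_freq /cube_mean !indicE.
  by rewrite !(in_setE, mem_setE) /=.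
Qed.

End Upper.

Lemma prob3_setX (R : realType) d1 d2 d3 (T1 : measurableType d1)
    (T2 : measurableType d2) (T3 : measurableType d3) (mu1 : probability T1 R)
    (mu2 : probability T2 R) (mu3 : probability T3 R) (A : set T1) (B : set T2)
    (C : set T3) : measurable A -> measurable B -> measurable C ->
  prob3 mu1 mu2 mu3 (A `*` B `*` C) = (mu1 A * mu2 B * mu3 C)%E.
Proof.
move=> mA mB mC; transitivity ((mu1 \x mu2) (A `*` B) * mu3 C)%E.
  by apply: product_measure1E => //; exact: measurableX.
by congr (_ * _)%E; exact: product_measure1E.
Qed.

(** * Upper bounds for both problems *)

Section UpperBounds.
Variables (R : realType) (a D1 D2 D3 : R).

Lemma le_ereal_sup_osc (T I : Type) (h : T -> I -> R) (c : R) :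
  (ereal_sup [set ereal_sup [set (h x i)%:E | i in [set: I]] | x in [set: T]]
    <= c%:E)%E ->
  forall x i, h x i <= c.
Proof.
move=> hc x i; rewrite -lee_fin; apply: le_trans hc.
apply: (@le_trans _ _ (ereal_sup [set (h x i)%:E | i in [set: I]])).
  by apply: ereal_sup_ubound; exists i.
by apply: ereal_sup_ubound; exists x.
Qed.

Lemma mcdiarmid_upper (X1 X2 X3 : ptopologicalType) :
  0 <= a -> D2 <= D1 -> D3 <= D2 -> 0 < D3 ->
  (optimal_bound a (@mcdiarmid_set R X1 X2 X3 D1 D2 D3) <=
    (Num.max (F1 a D1 D2 D3) (F2 a D2 D3))%:E)%E.
Proof.
move=> a0 D21 D32 D3_gt0; apply: ge_ereal_sup => _ [[f mu] [/= + + Ef] <-].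
move=> [mf osc1f osc2f osc3f] [mu1 [mu2 [mu3 /= muE]]]; subst mu.
have oscf : coord_osc D1 D2 D3 f.
  split=> [x x' y z|x y y' z|x y z z']; apply: le_trans (ler_norm _) _.
  - exact: (le_ereal_sup_osc osc1f (x, y, z) x').
  - exact: (le_ereal_sup_osc osc2f (x, y, z) y').
  - exact: (le_ereal_sup_osc osc3f (x, y, z) z').
have [x [y [z [p1 [p2 [p3 [[h1 h2 h3] oF F0 le_P]]]]]]] :=
  prob3_reduction a mf oscf Ef.
by apply: le_trans le_P _; rewrite lee_fin; exact: cube_mcdiarmid.
Qed.

(* The sum of the coordinates is unbounded on [R^3]; clamping each of them to
   its interval changes the sum on a null set only and makes it bounded. *)
Definition clamp (b D t : R) := Num.max (b - D) (Num.min b t).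

Lemma measurable_clamp b D : measurable_fun setT (clamp b D).
Proof.
by apply: measurable_maxr; [exact: measurable_cst|];
  apply: measurable_minr; [exact: measurable_cst|exact: measurable_id].
Qed.

Lemma clamp_id b D t : b - D <= t <= b -> clamp b D t = t.
Proof. by move=> /andP[? ?]; rewrite /clamp min_r// max_r. Qed.

Lemma clamp_osc b D t t' : 0 <= D -> clamp b D t - clamp b D t' <= D.
Proof.
move=> D0.
have : b - D <= clamp b D t' by rewrite le_max lexx.
have : clamp b D t <= b by rewrite ge_max ge_min lexx andbT gerBl.
by lra.
Qed.

Definition clamp_sum (b1 b2 b3 : R) (x : R * R * R) : R :=
  clamp b1 D1 x.1.1 + clamp b2 D2 x.1.2 + clamp b3 D3 x.2.

Lemma measurable_clamp_sum b1 b2 b3 : measurable_fun setT (clamp_sum b1 b2 b3).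
Proof.
apply: measurable_funD; [apply: measurable_funD|];
  apply: measurableT_comp => //; try exact: measurable_clamp;
  exact: measurableT_comp.
Qed.

Lemma clamp_sum_osc b1 b2 b3 : 0 <= D1 -> 0 <= D2 -> 0 <= D3 ->
  coord_osc D1 D2 D3 (clamp_sum b1 b2 b3).
Proof.
move=> D1_ge0 D2_ge0 D3_ge0; split=> [x x' y z|x y y' z|x y z z'];
  rewrite /clamp_sum /=.
- by have := clamp_osc b1 x x' D1_ge0; lra.
- by have := clamp_osc b2 y y' D2_ge0; lra.
- by have := clamp_osc b3 z z' D3_ge0; lra.
Qed.

(** The two functions agree on the product of the three intervals, which has probability 1. *)
Lemma clamp_sumE (b1 b2 b3 : R) (mu1 mu2 mu3 : probability R R) :
  mu1 `[b1 - D1, b1]%classic = 1%E -> mu2 `[b2 - D2, b2]%classic = 1%E ->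
  mu3 `[b3 - D3, b3]%classic = 1%E ->
  let g := fun x : R * R * R => x.1.1 + x.1.2 + x.2 in
  'E_(prob3 mu1 mu2 mu3)[g]%E = 'E_(prob3 mu1 mu2 mu3)[clamp_sum b1 b2 b3]%E /\
  prob3 mu1 mu2 mu3 [set x | a <= g x] =
  prob3 mu1 mu2 mu3 [set x | a <= clamp_sum b1 b2 b3 x].
Proof.
move=> mu1b mu2b mu3b g; have mg' := measurable_clamp_sum b1 b2 b3.
have mg : measurable_fun setT g.
  by apply: measurable_funD => //; apply: measurable_funD => //;
    apply: measurableT_comp.
pose S := `[b1 - D1, b1]%classic `*` `[b2 - D2, b2]%classic `*`
          `[b3 - D3, b3]%classic.
have S1 : prob3 mu1 mu2 mu3 S = 1%E.
  by rewrite prob3_setX// mu1b mu2b mu3b !mule1.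
have mS : measurable S by do !apply: measurableX.
have gg' : {ae prob3 mu1 mu2 mu3, forall x, g x = clamp_sum b1 b2 b3 x}.
  exists (~` S); split; first exact: measurableC.
    by rewrite probability_setC// S1 subee.
  move=> -[[x y] z] /= + [[]] /=; rewrite !in_itv/= => ggN x1 y2 z3.
  by apply: ggN; rewrite /g /clamp_sum /= !clamp_id.
have mset h : measurable_fun setT h ->
    measurable [set x : R * R * R | a <= h x].
  by move=> mh; rewrite -[X in measurable X]setTI; exact: measurable_fun_le.
split.
  rewrite unlock; apply: ae_eq_integral => //; try exact/measurable_EFinP.
  by apply: filterS gg' => x ->.
rewrite -!expectation_indic; [rewrite unlock|exact: mset|exact: mset].
apply: ae_eq_integral => //.
- by apply/measurable_EFinP/measurable_indic; exact: mset.
- by apply/measurable_EFinP/measurable_indic; exact: mset.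
- apply: filterS gg' => x ggx _; rewrite !indicE.
  by congr ((nat_of_bool _)%:R%:E); apply/idP/idP; rewrite !inE/= ggx.
Qed.

Lemma hoeffding_upper :
  0 <= a -> D2 <= D1 -> D3 <= D2 -> 0 < D3 ->
  (optimal_bound a (hoeffding_set D1 D2 D3) <= (F1 a D1 D2 D3)%:E)%E.
Proof.
move=> a0 D21 D32 D3_gt0; apply: ge_ereal_sup => _ [[f mu] [/= -> [+ +]] <-].
move=> [b1 [b2 [b3 [mu1 [mu2 [mu3 [mu1b mu2b mu3b /= muE]]]]]]]; subst mu => /=.
have [-> ->] := clamp_sumE mu1b mu2b mu3b => Ef.
have og : coord_osc D1 D2 D3 (clamp_sum b1 b2 b3).
  by apply: clamp_sum_osc; lra.
have [x [y [z [p1 [p2 [p3 [[h1 h2 h3] oF F0 le_P]]]]]]] :=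
  prob3_reduction a (measurable_clamp_sum b1 b2 b3) og Ef.
apply: le_trans le_P _; rewrite lee_fin.
exact: (@cube_hoeffding _ a D1 D2 D3 p1 p2 p3 (clamp b1 D1 \o x)
  (clamp b2 D2 \o y) (clamp b3 D3 \o z)).
Qed.

End UpperBounds.

(** * Extremal scenarios *)

Lemma Rintegral_indic_set (R : realType) d (T : measurableType d)
    (mu : probability T R) (A : set T) : measurable A ->
  (\int[mu]_t \1_A t)%:E = mu A.
Proof.
move=> mA; rewrite EFin_Rintegral; first by rewrite integral_indic// setIT.
split; first exact: measurable_indic.
by exists 1 => t; rewrite indicE ger0_norm ?lern1 ?leq_b1.
Qed.

Section Scenario.
Context (R : realType) d1 d2 d3 (T1 : measurableType d1)
  (T2 : measurableType d2) (T3 : measurableType d3).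
Variables (x : bool -> T1) (y : bool -> T2) (z : bool -> T3) (p1 p2 p3 : R).
Hypotheses (p1_01 : 0 <= p1 <= 1) (p2_01 : 0 <= p2 <= 1) (p3_01 : 0 <= p3 <= 1).

(** Conversely to [prob3_reduction], product laws on the cube are realized on the given spaces. The
    first three clauses provide the support condition in [hoeffding_set]. *)
Lemma two_point_scenario :
  exists (mu1 : probability T1 R) (mu2 : probability T2 R)
    (mu3 : probability T3 R), [/\
    forall A, measurable A -> (forall b, A (x b)) -> mu1 A = 1%E,
    forall A, measurable A -> (forall b, A (y b)) -> mu2 A = 1%E,
    forall A, measurable A -> (forall b, A (z b)) -> mu3 A = 1%E &
    forall (f : T1 * T2 * T3 -> R), bounded_measurable f ->
      let F b1 b2 b3 := f (x b1, y b2, z b3) in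
      'E_(prob3 mu1 mu2 mu3)[f]%E = (cube_mean p1 p2 p3 F)%:E /\
      forall a, prob3 mu1 mu2 mu3 [set t | (a <= f t)%R] =
                (cube_prob p1 p2 p3 a F)%:E].
Proof.
have [mu1 mu1E] := two_point_measure (x true) (x false) p1_01.
have [mu2 mu2E] := two_point_measure (y true) (y false) p2_01.
have [mu3 mu3E] := two_point_measure (z true) (z false) p3_01.
have full d (T : measurableType d) (w : bool -> T) (p : R)
    (mu : probability T R) :
    (forall f, bounded_measurable f ->
      \int[mu]_t f t = mix p (f (w true)) (f (w false))) ->
    forall A, measurable A -> (forall b, A (w b)) -> mu A = 1%E.
  move=> muE A mA Aw; rewrite -Rintegral_indic_set// muE; last first.
    split; first exact: measurable_indic.
    by exists 1 => t; rewrite indicE ger0_norm ?lern1 ?leq_b1.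
  by rewrite !indicE !mem_set// /mix !mulr1 subrKC.
exists mu1, mu2, mu3.
split; [exact: full mu1E|exact: full mu2E|exact: full mu3E|].
have int3 (f : T1 * T2 * T3 -> R) : bounded_measurable f ->
    \int[prob3 mu1 mu2 mu3]_t f t =
    cube_mean p1 p2 p3 (fun b1 b2 b3 => f (x b1, y b2, z b3)).
  move=> bf; rewrite -(Rintegral_prod (mu1 \x mu2)%E mu3 bf) mu3E; last first.
    exact: (bm_Rintegral (mu1 \x mu2)%E mu3 bf).
  rewrite -!(Rintegral_prod mu1 mu2); try exact: (bm_section _ bf).
  rewrite !mu2E; try exact: (bm_Rintegral mu1 mu2 (bm_section _ bf)).
  rewrite !mu1E; try exact: (bm_section _ (bm_section _ bf)).
  by rewrite /cube_mean /mix; ring.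
move=> f bf F; split; first by rewrite unlock -EFin_Rintegral// int3.
move=> a; have [mf _] := bf.
rewrite -Rintegral_indic_set; last first.
  by rewrite -[X in measurable X]setTI; exact: measurable_fun_le.
rewrite int3; last exact: bm_superlevel.
rewrite /cube_prob /cube_freq /cube_mean !indicE.
by rewrite !(in_setE, mem_setE) /=.
Qed.

End Scenario.

(** * Transporting cube functions to admissible scenarios *)

Section LowerBounds.
Variables (R : realType) (a D1 D2 D3 p1 p2 p3 : R).

Lemma hoeffding_lower (x y z : bool -> R) (b1 b2 b3 : R) :
  0 <= p1 <= 1 -> 0 <= p2 <= 1 -> 0 <= p3 <= 1 ->
  0 <= D1 -> 0 <= D2 -> 0 <= D3 ->
  (forall b, b1 - D1 <= x b <= b1) -> (forall b, b2 - D2 <= y b <= b2) ->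
  (forall b, b3 - D3 <= z b <= b3) ->
  let F b1 b2 b3 := x b1 + y b2 + z b3 in
  cube_mean p1 p2 p3 F <= 0 ->
  ((cube_prob p1 p2 p3 a F)%:E <= optimal_bound a (hoeffding_set D1 D2 D3))%E.
Proof.
move=> h1 h2 h3 D1_ge0 D2_ge0 D3_ge0 xb yb zb F F0.
have [mu1 [mu2 [mu3 [full1 full2 full3 muF]]]] :=
  two_point_scenario x y z h1 h2 h3.
have {}full1 : mu1 `[b1 - D1, b1]%classic = 1%E.
  by apply: full1 => // b; rewrite /= in_itv/=.
have {}full2 : mu2 `[b2 - D2, b2]%classic = 1%E.
  by apply: full2 => // b; rewrite /= in_itv/=.
have {}full3 : mu3 `[b3 - D3, b3]%classic = 1%E.
  by apply: full3 => // b; rewrite /= in_itv/=.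
(* The integral formula [muF] asks for a bounded function: it is applied to the clamped sum, which
   equals the plain sum at the atoms. *)
have [Eg Pg] := clamp_sumE a full1 full2 full3.
have bm := coord_osc_bounded (measurable_clamp_sum D1 D2 D3 b1 b2 b3)
  (clamp_sum_osc b1 b2 b3 D1_ge0 D2_ge0 D3_ge0).
have [EF PF] := muF _ bm.
have FE : (fun c1 c2 c3 => clamp_sum D1 D2 D3 b1 b2 b3 (x c1, y c2, z c3)) = F.
  by apply/funext => c1; apply/funext => c2; apply/funext => c3;
    rewrite /clamp_sum /= !clamp_id.
rewrite /= FE in EF PF.
rewrite -PF -Pg; apply: ereal_sup_ubound.
exists ((fun t : R * R * R => t.1.1 + t.1.2 + t.2), prob3 mu1 mu2 mu3) => //.
split => //=; split; last by rewrite Eg EF lee_fin.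
by exists b1, b2, b3, mu1, mu2, mu3.
Qed.

(** Each space has one atom in either part of its partition, and the function depends only on the
    parts, so [G] is carried over with its oscillations. *)
Lemma mcdiarmid_lower (X1 X2 X3 : ptopologicalType)
    (G : bool -> bool -> bool -> R) :
  0 <= p1 <= 1 -> 0 <= p2 <= 1 -> 0 <= p3 <= 1 ->
  splits_in_two X1 -> splits_in_two X2 -> splits_in_two X3 ->
  cube_osc D1 D2 D3 G -> cube_mean p1 p2 p3 G <= 0 ->
  ((cube_prob p1 p2 p3 a G)%:E <=
    optimal_bound a (@mcdiarmid_set R X1 X2 X3 D1 D2 D3))%E.
Proof.
move=> h1 h2 h3 [A1 [mA1 [x1 Ax1] [x0 Ax0]]] [A2 [mA2 [y1 Ay1] [y0 Ay0]]].
move=> [A3 [mA3 [z1 Az1] [z0 Az0]]] oG G0.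
pose x b := if b then x1 else x0; pose y b := if b then y1 else y0.
pose z b := if b then z1 else z0.
have xA b : (x b \in A1) = b.
  by case: b; [exact: mem_set|exact: memNset].
have yA b : (y b \in A2) = b.
  by case: b; [exact: mem_set|exact: memNset].
have zA b : (z b \in A3) = b.
  by case: b; [exact: mem_set|exact: memNset].
have [mu1 [mu2 [mu3 [_ _ _ muF]]]] :=
  @two_point_scenario R _ _ _ (borel_type X1) (borel_type X2) (borel_type X3)
    x y z p1 p2 p3 h1 h2 h3.
pose f (t : borel_type X1 * borel_type X2 * borel_type X3) :=
  G (t.1.1 \in A1) (t.1.2 \in A2) (t.2 \in A3).
have [oG1 oG2 oG3] := oG.
have oscf : coord_osc D1 D2 D3 f by split => *; rewrite /f.
have mf : measurable_fun setT f.
  have mem d (T : measurableType d) (A : set T) : measurable A ->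
      measurable_fun setT (fun t => t \in A).
    move=> mA; apply: (measurable_fun_bool true); rewrite setTI.
    by rewrite (_ : _ @^-1` _ = A)//; apply/seteqP; split => t /=;
      [move/set_mem|move/mem_set].
  rewrite (_ : f = fun t => if t.1.1 \in A1 then
      (if t.1.2 \in A2 then (if t.2 \in A3 then G true true true
                             else G true true false)
       else (if t.2 \in A3 then G true false true else G true false false))
    else
      (if t.1.2 \in A2 then (if t.2 \in A3 then G false true true
                             else G false true false)
       else (if t.2 \in A3 then G false false true
             else G false false false))); last first.
    by apply/funext => t; rewrite /f; do 3!case: (_ \in _).
  have m1 : measurable_fun setT
      (fun t : borel_type X1 * borel_type X2 * borel_type X3 => t.1.1 \in A1).
    by apply: (measurableT_comp (mem _ _ _ mA1)); exact: measurableT_comp.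
  have m2 : measurable_fun setT
      (fun t : borel_type X1 * borel_type X2 * borel_type X3 => t.1.2 \in A2).
    by apply: (measurableT_comp (mem _ _ _ mA2)); exact: measurableT_comp.
  have m3 : measurable_fun setT
      (fun t : borel_type X1 * borel_type X2 * borel_type X3 => t.2 \in A3).
    by apply: (measurableT_comp (mem _ _ _ mA3)).
  by do !apply: measurable_fun_ifT => //.
have [EF PF] := muF _ (coord_osc_bounded mf oscf).
have FE : (fun c1 c2 c3 => f (x c1, y c2, z c3)) = G.
  by apply/funext => c1; apply/funext => c2; apply/funext => c3;
    rewrite /f /= xA yA zA.
rewrite FE in EF PF.
rewrite -PF; apply: ereal_sup_ubound; exists (f, prob3 mu1 mu2 mu3) => //.
split => /=; [|by exists mu1, mu2, mu3|by rewrite EF lee_fin].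
split => //; apply: ge_ereal_sup => _ [t _ <-];
  apply: ge_ereal_sup => _ [i _ <-]; rewrite lee_fin ler_norml /f /=.
- by apply/andP; split; [rewrite lerNl opprB|]; exact: oG1.
- by apply/andP; split; [rewrite lerNl opprB|]; exact: oG2.
- by apply/andP; split; [rewrite lerNl opprB|]; exact: oG3.
Qed.

End LowerBounds.

Section Extremal.
Variables (R : realType) (a D1 D2 D3 : R).

(** This is [t] minus the weighted Hamming distance to [111], written as a sum of one-coordinate
    terms so that it suits both problems. *)
Definition corner (t : R) (b1 b2 b3 : bool) : R :=
  (t - D1 * (~~ b1)%:R) + (0 - D2 * (~~ b2)%:R) + (0 - D3 * (~~ b3)%:R).

(** Take [t = a] when the constraint of [F1_attained] holds. Otherwise [F1] is 0, and [t = 0]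
    already makes the mean nonpositive. *)
Lemma F1_corner :
  0 <= a -> D2 <= D1 -> D3 <= D2 -> 0 < D3 ->
  exists p1 p2 p3 t, [/\ 0 <= p1 <= 1, 0 <= p2 <= 1, 0 <= p3 <= 1,
    cube_mean p1 p2 p3 (corner t) <= 0 &
    F1 a D1 D2 D3 <= cube_prob p1 p2 p3 a (corner t)].
Proof.
move=> a0 D21 D32 D3_gt0.
have [q1 [q2 [q3 [h1 h2 h3 aq F1E]]]] := F1_attained a0 D21 D32 D3_gt0.
have rev (q : R) : 0 <= q <= 1 -> 0 <= 1 - q <= 1.
  by move=> /andP[? ?]; apply/andP; split; lra.
have h1' := rev _ h1; have h2' := rev _ h2; have h3' := rev _ h3.
exists (1 - q1), (1 - q2), (1 - q3).
have mean t : cube_mean (1 - q1) (1 - q2) (1 - q3) (corner t) =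
    t - (D1 * q1 + D2 * q2 + D3 * q3).
  by rewrite /cube_mean /mix /corner /=; ring.
case: aq => [aq|F10].
  exists a; split => //; first by rewrite mean subr_le0.
  rewrite -F1E (_ : _ * _ = cube_mean (1 - q1) (1 - q2) (1 - q3)
    (fun b1 b2 b3 => (b1 && b2 && b3)%:R)).
    apply: le_cube_mean => // -[] [] []; rewrite ?ler0n//= /corner.
    by rewrite !mulr0 !subr0 !addr0 lexx.
  by rewrite /cube_mean /mix /=; ring.
exists 0; split => //.
  rewrite mean sub0r oppr_le0.
  have /andP[? _] := h1; have /andP[? _] := h2; have /andP[? _] := h3.
  by rewrite !addr_ge0// mulr_ge0//; lra.
by rewrite F10; have /andP[] :=
  cube_freq_itv (fun b1 b2 b3 => a <= corner 0 b1 b2 b3) h1' h2' h3'.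
Qed.

Lemma F1_le_hoeffding :
  0 <= a -> D2 <= D1 -> D3 <= D2 -> 0 < D3 ->
  ((F1 a D1 D2 D3)%:E <= optimal_bound a (hoeffding_set D1 D2 D3))%E.
Proof.
move=> a0 D21 D32 D3_gt0.
have [p1 [p2 [p3 [t [h1 h2 h3 mean0 F1_le]]]]] := F1_corner a0 D21 D32 D3_gt0.
apply: (@le_trans _ _ (cube_prob p1 p2 p3 a (corner t))%:E).
  by rewrite lee_fin.
have itv (D s : R) (b : bool) : 0 <= D -> s - D <= s - D * (~~ b)%:R <= s.
  by move=> D0; case: b; rewrite /= ?mulr0 ?mulr1 ?subr0 lexx ?andbT gerBl.
by apply: (@hoeffding_lower _ a D1 D2 D3 _ _ _ (fun b => t - D1 * (~~ b)%:R)
  (fun b => 0 - D2 * (~~ b)%:R) (fun b => 0 - D3 * (~~ b)%:R) t 0 0) => //;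
  try (move=> b; apply: itv); lra.
Qed.

Lemma F1_le_mcdiarmid (X1 X2 X3 : ptopologicalType) :
  0 <= a -> D2 <= D1 -> D3 <= D2 -> 0 < D3 ->
  splits_in_two X1 -> splits_in_two X2 -> splits_in_two X3 ->
  ((F1 a D1 D2 D3)%:E <=
    optimal_bound a (@mcdiarmid_set R X1 X2 X3 D1 D2 D3))%E.
Proof.
move=> a0 D21 D32 D3_gt0 s1 s2 s3.
have [p1 [p2 [p3 [t [h1 h2 h3 mean0 F1_le]]]]] := F1_corner a0 D21 D32 D3_gt0.
apply: (@le_trans _ _ (cube_prob p1 p2 p3 a (corner t))%:E).
  by rewrite lee_fin.
apply: mcdiarmid_lower => //.
by split; rewrite /corner => -[] [] [] [] /=; lra.
Qed.

(** Positivity selects a root with [phi = 1]; [g] is its real part and [t] the value of [theta]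
    there. *)
Lemma F2_gt0_majority :
  0 < D3 -> 0 < F2 a D2 D3 ->
  exists g t, [/\ 0 <= g <= 1, 0 <= t <= 1,
    D3 * (1 - t) * (1 - g ^+ 2) + D2 * (1 - g) ^+ 2 = a &
    F2 a D2 D3 = majority g g t].
Proof.
move=> D3_gt0.
have key z : 0 < phi_psi a D2 D3 z -> exists g t, [/\ 0 <= g <= 1, 0 <= t <= 1,
    D3 * (1 - t) * (1 - g ^+ 2) + D2 * (1 - g) ^+ 2 = a &
    phi_psi a D2 D3 z = majority g g t].
  rewrite /phi_psi /phi.
  case: (boolP [&& _, _ & _]) => [|_]; last by rewrite mul0r ltxx.
  move=> /and3P[_ /andP[g0 g1] /andP[t0 t1]] _; rewrite mul1r.
  have g01 : 0 <= complex.Re z < 1 by rewrite ltW.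
  exists (complex.Re z), (theta a D2 D3 (complex.Re z)).
  rewrite (ltW g0) (ltW g1) (ltW t0) (ltW t1) psiE//; split => //.
    by have := thetaE a D2 D3_gt0 g01; lra.
  by rewrite /majority; ring.
have maxE (u v : R) : Num.max u v = u \/ Num.max u v = v.
  by rewrite maxEle; case: ifP; [right|left].
rewrite /F2; set u := phi_psi _ _ _ _; set v := phi_psi _ _ _ _.
set w := phi_psi _ _ _ _.
by case: (maxE (Num.max u v) w) => ->; [case: (maxE u v) => ->|]; exact: key.
Qed.

Lemma F2_le_mcdiarmid (X1 X2 X3 : ptopologicalType) :
  D2 <= D1 -> D3 <= D2 -> 0 < D3 -> 0 < F2 a D2 D3 ->
  splits_in_two X1 -> splits_in_two X2 -> splits_in_two X3 ->
  ((F2 a D2 D3)%:E <=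
    optimal_bound a (@mcdiarmid_set R X1 X2 X3 D1 D2 D3))%E.
Proof.
move=> D21 D32 D3_gt0 F2_gt0 s1 s2 s3.
have [g [t [g01 t01 aE ->]]] := F2_gt0_majority D3_gt0 F2_gt0.
(* [G] is [a] minus the charge used in [cube_mcdiarmid]; by [aE] its mean is exactly zero. *)
pose G b1 b2 b3 := a - (D2 * (~~ b1 && ~~ b2)%:R +
                        D3 * (~~ b3 && ~~ (b1 && b2))%:R).
apply: (@le_trans _ _ (cube_prob g g t a G)%:E); last first.
  apply: mcdiarmid_lower => //.
    by split; rewrite /G => -[] [] [] [] /=; lra.
  by rewrite /cube_mean /mix /G /=; lra.
rewrite lee_fin (_ : majority _ _ _ = cube_mean g g t
  (fun b1 b2 b3 => ((b1 && b2) || (b3 && (b1 || b2)))%:R)).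
  apply: le_cube_mean => // -[] [] []; rewrite ?ler0n//= /G /=;
    by rewrite !mulr0 !addr0 subr0 lexx.
by rewrite /majority /cube_mean /mix /=; ring.
Qed.

End Extremal.

Theorem theorem5p13 (R : realType) (a D1 D2 D3 : R)
    (X1 X2 X3 : ptopologicalType) :
  0 <= a -> D2 <= D1 -> D3 <= D2 -> 0 < D3 ->
  suslin_space R X1 -> suslin_space R X2 -> suslin_space R X3 ->
  splits_in_two X1 -> splits_in_two X2 -> splits_in_two X3 ->
  (F2 a D2 D3 <= F1 a D1 D2 D3 ->
     optimal_bound a (hoeffding_set D1 D2 D3) =
     optimal_bound a (@mcdiarmid_set R X1 X2 X3 D1 D2 D3)) /\
  (F1 a D1 D2 D3 < F2 a D2 D3 ->
     (optimal_bound a (hoeffding_set D1 D2 D3) <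
      optimal_bound a (@mcdiarmid_set R X1 X2 X3 D1 D2 D3))%E).
Proof.
move=> a0 D21 D32 D3_gt0 _ _ _ s1 s2 s3.
have F1_ge0 := F1_ge0 a0 D21 D32 D3_gt0.
have -> : optimal_bound a (hoeffding_set D1 D2 D3) = (F1 a D1 D2 D3)%:E.
  by apply/le_anti; rewrite hoeffding_upper//= F1_le_hoeffding.
split=> [F21|F12].
  apply/le_anti; rewrite F1_le_mcdiarmid//=.
  by rewrite -(max_idPl F21) mcdiarmid_upper.
apply: (@lt_le_trans _ _ (F2 a D2 D3)%:E); first by rewrite lte_fin.
by apply: F2_le_mcdiarmid => //; exact: le_lt_trans F12.
Qed.
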